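(* Let $\lambda\ge\omega_2$ be a cardinal. Assume that there is a good $(\omega_1,\lambda)$-LLSP space that is admissible. Then for every ordinal $\alpha<\lambda^+$ there is a good $(\omega_1,\alpha)$-LLSP space.
   Context: A P-space is a space in which every countable intersection of open sets is open. For a space $X$, $X^{\alpha}$ is the $\alpha$-th Cantor–Bendixson derivative; $X$ is scattered if $X^{\alpha}=\emptyset$ for some $\alpha$. For scattered $X$: $\mathrm{ht}(X)$ is the least $\alpha$ with $X^{\alpha}=\emptyset$; $I_\alpha(X)=X^{\alpha}\setminus X^{\alpha+1}$; $\mathrm{wd}(X)=\sup\{|I_\alpha(X)|:\alpha<\mathrm{ht}(X)\}$; the level $\rho(x)$ of $x$ is the $\alpha$ with $x\in I_\alpha(X)$. A neighbourhood $U$ of $x$ is a cone on $x$ if $x$ is the only point of $U$ of level $\ge\rho(x)$. An LLSP space is a locally Lindelöf, scattered, Hausdorff P-space; a $(\kappa,\alpha)$-LLSP space is an LLSP space with height $\alpha$ and width $\kappa$. An LLSP space $X$ is good if for every ordinal $\alpha<\mathrm{ht}(X)$ and every countable family $\{U_n:n\in\omega\}$ of Lindelöf clopen cones on points of $X$, the set $I_\alpha(X)\setminus\bigcup_n U_n$ is uncountable. For an LLSP space $X$, $\beta+1<\mathrm{ht}(X)$ and $x\in I_{\beta+1}(X)$, a neighbourhood basis $\mathbb B_x$ of $x$ is admissible if there is a pairwise disjoint family $\{U_\nu:\nu<\omega_1\}$, each $U_\nu$ a Lindelöf clopen cone on some point $x_\nu\in I_\beta(X)$, such that $\mathbb B_x$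 is the collection of all sets $\{x\}\cup\bigcup\{U_\nu:\nu\ge\xi\}$ with $\xi<\omega_1$ (we say $\mathbb B_x$ is given by $\{U_\nu:\nu<\omega_1\}$). $X$ is admissible if there is a choice of neighbourhood bases $\mathbb B_x$ ($x\in X$) such that for every successor ordinal $\beta+1<\mathrm{ht}(X)$: (1) $\mathbb B_x$ is admissible for every $x\in I_{\beta+1}(X)$; (2) if $x\ne y$ are in $I_{\beta+1}(X)$, $\mathbb B_x$ is given by $\{U_\nu:\nu<\omega_1\}$ and $\mathbb B_y$ by $\{U'_\nu:\nu<\omega_1\}$, then $U_\nu\cap U'_\mu=\emptyset$ for all $\nu,\mu<\omega_1$.
   Formalization: The ordinal α is taken to be nonzero: a space of height 0 is empty and so has width sup ∅ = 0, not ω₁, hence no (ω₁,0)-LLSP space exists and the claim fails at α = 0. *)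

(* Defs.v *)
From HB Require Import structures.
From mathcomp Require Import all_boot all_order.
From mathcomp Require Import all_classical topology.

Set Implicit Arguments.
Unset Strict Implicit.
Unset Printing Implicit Defensive.

Import Order.TTheory.

Local Open Scope classical_set_scope.
Local Open Scope quotient_scope.
Local Open Scope card_scope.
Local Open Scope order_scope.

(* [OrdSup f] denotes the least ordinal strictly greater than all the [f a]; *)
(* [ord] consists of these codes up to mutual comparison: by [ord_lt_wf] and *)
(* [ord_strict_ub] below it is well ordered and every family indexed by a    *)
(* (small) type has a strict upper bound.                                    *)
Inductive ord_code : Type := OrdSup (A : Type) (f : A -> ord_code).

Fixpoint code_le (s t : ord_code) {struct s} : Prop :=
  match s, t with
  | OrdSup A f, OrdSup B g => forall a : A, exists b : B, code_le (f a) (g b)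
  end.

Definition code_lt (s t : ord_code) : Prop :=
  match t with OrdSup B g => exists b : B, code_le s (g b) end.

Lemma code_le_refl s : code_le s s.
Proof. by elim: s => A f IH a; exists a; exact: IH. Qed.

Lemma code_le_trans s t u : code_le s t -> code_le t u -> code_le s u.
Proof.
elim: s t u => A f IH [B g] [C h] /= fg gh a.
have [b fagb] := fg a; have [c gbhc] := gh b.
by exists c; exact: IH fagb gbhc.
Qed.

Lemma code_leP s t : code_le s t <-> forall u, code_lt u s -> code_lt u t.
Proof.
case: s t => A f [B g]; split=> [fg u [a ufa]|fg a].
  have [b fagb] := fg a; exists b; exact: code_le_trans ufa fagb.
by apply: (fg (f a)); exists a; exact: code_le_refl.
Qed.

Lemma code_le_total s t : code_le s t \/ code_lt t s.
Proof.
elim: s t => A f IH [B g].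
have [?|/existsNP[a /forallNP ngf]] :=
  pselect (forall a, exists b, code_le (f a) (g b)); first by left.
right; exists a; apply/code_leP => u [b ugb].
have [/ngf//|gbfa] := IH a (g b).
case: (f a) gbfa => C h [c gbhc]; exists c; exact: code_le_trans ugb gbhc.
Qed.

Lemma code_leNgt s t : code_le s t -> ~ code_lt t s.
Proof.
elim: s t => A f IH t + [a tfa] => /code_leP ft.
by apply: (IH a (f a) (code_le_refl _)); apply: (iffLR (code_leP _ _) tfa);
  apply: ft; exists a; exact: code_le_refl.
Qed.

Lemma code_ltW s t : code_lt s t -> code_le s t.
Proof.
elim: s t => A f IH [B g] [b /code_leP fgb] a; exists b; apply: IH.
by apply: fgb; exists a; exact: code_le_refl.
Qed.

HB.instance Definition _ := gen_eqMixin ord_code.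
HB.instance Definition _ := gen_choiceMixin ord_code.

Definition code_eqv (s t : ord_code) : bool :=
  `[< code_le s t /\ code_le t s >].

Lemma code_eqv_refl : reflexive code_eqv.
Proof. by move=> s; apply/asboolP; split; exact: code_le_refl. Qed.

Lemma code_eqv_sym : symmetric code_eqv.
Proof. by move=> s t; apply/asboolP/asboolP => -[]. Qed.

Lemma code_eqv_trans : transitive code_eqv.
Proof.
move=> t s u /asboolP[st ts] /asboolP[tu ut]; apply/asboolP.
by split; [exact: code_le_trans st tu|exact: code_le_trans ut ts].
Qed.

Canonical code_equiv_rel :=
  EquivRel code_eqv code_eqv_refl code_eqv_sym code_eqv_trans.

Definition ord := {eq_quot code_eqv}.

HB.instance Definition _ := Choice.on ord.
HB.instance Definition _ := EqQuotient.on ord.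

Definition ord_le (a b : ord) : bool := `[< code_le (repr a) (repr b) >].

Lemma ord_le_refl : reflexive ord_le.
Proof. by move=> a; apply/asboolP; exact: code_le_refl. Qed.

Lemma ord_le_anti : antisymmetric ord_le.
Proof.
move=> a b /andP[/asboolP ab /asboolP ba].
by rewrite -[a]reprK -[b]reprK; apply/eqmodP/asboolP.
Qed.

Lemma ord_le_trans : transitive ord_le.
Proof.
by move=> b a c /asboolP ab /asboolP bc; apply/asboolP/(code_le_trans ab).
Qed.

Lemma ord_le_total : total ord_le.
Proof.
move=> a b; apply/orP.
have [|/code_ltW] := code_le_total (repr a) (repr b).
  by left; apply/asboolP.
by right; apply/asboolP.
Qed.

Fact ord_display : Order.disp_t. Proof. exact: Order.Disp tt tt. Qed.

HB.instance Definition _ := Order.Le_isPOrder.Build ord_display ord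
  ord_le_refl ord_le_anti ord_le_trans.
HB.instance Definition _ :=
  Order.POrder_isTotal.Build ord_display ord ord_le_total.

Lemma ord_leE (s t : ord_code) :
  (\pi_ord s <= \pi_ord t) = `[< code_le s t >].
Proof.
have rE u : code_le (repr (\pi_ord u)) u /\ code_le u (repr (\pi_ord u)).
  have /eqmodP/asboolP // : repr (\pi_ord u) = u %[mod ord] by rewrite reprK.
apply/asboolP/asboolP => st.
  exact: (code_le_trans (code_le_trans (rE s).2 st) (rE t).1).
exact: (code_le_trans (code_le_trans (rE s).1 st) (rE t).2).
Qed.

Lemma ord_ltE (s t : ord_code) :
  (\pi_ord s < \pi_ord t) = `[< code_lt s t >].
Proof.
rewrite ltNge ord_leE; apply/negP/asboolP.
  by have [/asboolP ts /(_ ts)//|] := code_le_total t s.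
by move=> st /asboolP /code_leNgt.
Qed.

Lemma ord_lt_wf : well_founded (fun a b : ord => a < b).
Proof.
move=> a; rewrite -[a]reprK; move: (repr a) => {a}.
elim=> A f IH; constructor=> b; rewrite -[b]reprK ord_ltE => /asboolP[a].
move=> bfa; constructor=> c cb.
apply: (Acc_inv (IH a)); apply: lt_le_trans cb _.
by rewrite ord_leE; apply/asboolP.
Qed.

Lemma ord_strict_ub (A : Type) (f : A -> ord) : exists b, forall a, f a < b.
Proof.
exists (\pi_ord (OrdSup (fun a => repr (f a)))) => a.
rewrite -[f a]reprK ord_ltE; apply/asboolP; exists a.
exact: code_le_refl.
Qed.

Definition ord_zero : ord :=
  \pi_ord (OrdSup (fun e : False => match e with end)).

Lemma ord_zero_le (a : ord) : ord_zero <= a.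
Proof.
by rewrite -[a]reprK ord_leE; apply/asboolP; case: (repr a) => A f [].
Qed.

(* [ord_zero] if [P] is empty. *)
Definition least (P : set ord) : ord := xget ord_zero (P `&` lbound P).

Lemma leastP (P : set ord) : P !=set0 -> P (least P) /\ lbound P (least P).
Proof.
move=> [a Pa]; apply: (@xgetPex _ ord_zero (P `&` lbound P)).
elim/(well_founded_ind ord_lt_wf): a Pa => a IH Pa.
have [[b [Pb ba]]|na] := pselect (exists b, P b /\ b < a); first exact: IH Pb.
exists a; split=> // b Pb; rewrite leNgt; apply/negP => ba.
by apply: na; exists b.
Qed.

Definition osucc (a : ord) : ord := least [set b | a < b].

Definition below (a : ord) : set ord := [set b | b < a].

Definition is_cardinal (k : ord) : Prop :=
  forall a, a < k -> ~~ (below a #= below k).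

Definition card_succ (k : ord) : ord := least [set m | is_cardinal m /\ k < m].

Definition omega1 : ord := least [set a | ~ countable (below a)].
Definition omega2 : ord := card_succ omega1.

Section CantorBendixson.
Variable X : topologicalType.

(* [cb_derivative a] is the intersection of the derivatives of the earlier   *)
(* stages; the usual three clauses are the lemmas that follow.               *)
Definition cb_derivative : ord -> set X :=
  Fix ord_lt_wf (fun=> set X)
    (fun a rec => [set x | forall b (ba : b < a),
                     (rec b ba `\` isolated (rec b ba)) x]).

Lemma cb_derivativeE a : cb_derivative a =
  \bigcap_(b in below a) (cb_derivative b `\` isolated (cb_derivative b)).
Proof.
rewrite /cb_derivative Fix_eq // => b f g fg; apply/seteqP.
by split=> x /= h c cb; move: (h c cb); rewrite fg.
Qed.

Lemma cb_derivative_le a b : a <= b -> cb_derivative b `<=` cb_derivative a.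
Proof.
move=> ab x; rewrite !cb_derivativeE => h c /= ca.
by apply: h; exact: lt_le_trans ca ab.
Qed.

Lemma cb_derivative0 : cb_derivative ord_zero = setT.
Proof.
rewrite cb_derivativeE; apply/seteqP; split=> // x _ b /= b0.
by have := ord_zero_le b; rewrite leNgt b0.
Qed.

Lemma cb_derivativeS a :
  cb_derivative (osucc a) = cb_derivative a `\` isolated (cb_derivative a).
Proof.
have [|/= aS minS] := @leastP [set b | a < b].
  have [b ab] := ord_strict_ub (fun _ : unit => a).
  by exists b; exact: ab tt.
rewrite -/(osucc a) in aS minS.
rewrite [LHS]cb_derivativeE; apply/seteqP.
split=> [x /(_ a aS) //|x xa b /= bS].
have ba : b <= a by rewrite leNgt; apply/negP => /minS; rewrite leNgt bS.
move: ba; rewrite le_eqVlt => /predU1P[->//|ba].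
by have := cb_derivative_le (lexx a) xa.1; rewrite cb_derivativeE => /(_ b ba).
Qed.

Lemma cb_derivative_lim a : (forall b, b < a -> osucc b < a) ->
  cb_derivative a = \bigcap_(b in below a) cb_derivative b.
Proof.
move=> lima; apply/seteqP; split=> x.
  by move=> xa b /= ba; exact: cb_derivative_le (ltW ba) _ xa.
by move=> h; rewrite cb_derivativeE => b /lima /h; rewrite cb_derivativeS.
Qed.

Definition scattered : Prop := exists a, cb_derivative a = set0.

Definition height : ord := least [set a | cb_derivative a = set0].

Definition cb_level (a : ord) : set X :=
  cb_derivative a `\` cb_derivative (osucc a).

(* The supremum, in the class of cardinals, of the cardinalities of the      *)
(* levels; a cardinal [k] has [below k] as a set of that cardinality.        *)
Definition width : ord :=
  least [set k | is_cardinal k /\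
    forall a, a < height -> cb_level a #<= below k].

Definition level_of (x : X) : ord := xget ord_zero [set a | cb_level a x].

Definition cone_on (x : X) (U : set X) : Prop :=
  nbhs x U /\ forall y, U y -> level_of x <= level_of y -> y = x.

End CantorBendixson.

Arguments cb_derivative : clear implicits.
Arguments cb_level : clear implicits.

Definition P_space (X : topologicalType) : Prop :=
  forall U : nat -> set X, (forall n, open (U n)) -> open (\bigcap_n U n).

Definition lindelof (X : topologicalType) (A : set X) : Prop :=
  forall C : set (set X), C `<=` open -> A `<=` \bigcup_(V in C) V ->
    exists C', [/\ C' `<=` C, countable C' & A `<=` \bigcup_(V in C') V].

Definition locally_lindelof (X : topologicalType) : Prop :=
  forall x : X, exists2 U, nbhs x U & lindelof U.

Definition LLSP (X : topologicalType) : Prop :=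
  [/\ locally_lindelof X, scattered X, hausdorff_space X & P_space X].

Definition LLSP_of (k a : ord) (X : topologicalType) : Prop :=
  [/\ LLSP X, height X = a & width X = k].

Definition lindelof_clopen_cone (X : topologicalType) (x : X) (U : set X) :=
  [/\ lindelof U, clopen U & cone_on x U].

Definition good (X : topologicalType) : Prop :=
  forall (a : ord) (U : nat -> set X), a < height X ->
    (forall n, exists x, lindelof_clopen_cone x (U n)) ->
    ~ countable (cb_level X a `\` \bigcup_n U n).

Definition nbhs_basis (X : topologicalType) (x : X) (B : set (set X)) : Prop :=
  B `<=` nbhs x /\ forall V, nbhs x V -> exists2 W, B W & W `<=` V.

(* [B] is given by the family of the [U nu] for [nu < omega1], for a point   *)
(* [x] of level [osucc b]; the values of [U] beyond [omega1] are irrelevant. *)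
Definition given_by (X : topologicalType) (b : ord) (x : X)
    (B : set (set X)) (U : ord -> set X) : Prop :=
  [/\ trivIset (below omega1) U,
      forall nu, nu < omega1 ->
        exists2 y, cb_level X b y & lindelof_clopen_cone y (U nu)
    & B = [set [set x] `|` \bigcup_(nu in [set nu | xi <= nu < omega1]) U nu
          | xi in below omega1] ].

Definition admissible (X : topologicalType) : Prop :=
  exists B : X -> set (set X), (forall x, nbhs_basis x (B x)) /\
    forall b, osucc b < height X ->
      (forall x, cb_level X (osucc b) x -> exists U, given_by b x (B x) U) /\
      (forall x y, x <> y -> cb_level X (osucc b) x -> cb_level X (osucc b) y ->
        forall U U', given_by b x (B x) U -> given_by b y (B y) U' ->
          forall nu mu, nu < omega1 -> mu < omega1 ->
            U nu `&` U' mu = set0).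

(* Main.v *)
(* By induction on [alpha].  Fix a strictly increasing continuous [sg] that   *)
(* maps some [th <= lambda] cofinally into [alpha], write                     *)
(* [sg (b + 1) = sg b + gam b] with [gam b < alpha], and take a good space    *)
(* [S b] of height [gam b] by induction.  In the first [th] levels of [X],    *)
(* admissibility gives for each point [x] of level [b + 1] disjoint cones     *)
(* [U nu], [nu < omega1], on points of level [b]; identify these points with  *)
(* the isolated points of a copy of the one-point Lindelofication of [S b],   *)
(* whose point at infinity is [x].  Below every such [x] this inserts the     *)
(* levels strictly between [0] and [gam b] of [S b], so that level [b] of [X] *)
(* becomes level [sg b].  Every basic neighbourhood in the new space projects *)
(* into a countable union of Lindelof cones of [X]; since [X] is good, this   *)
(* leaves uncountably many points of each old level uncovered, and for a new  *)
(* level it leaves a whole inserted copy of some [S b] untouched.             *)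

Require Import Defs.
From HB Require Import structures.
From mathcomp Require Import all_boot all_order.
From mathcomp Require Import all_classical topology.

Set Implicit Arguments.
Unset Strict Implicit.
Unset Printing Implicit Defensive.

Import Order.TTheory.

Local Open Scope quotient_scope.
Local Open Scope card_scope.
Local Open Scope order_scope.
Local Open Scope classical_set_scope.

(** * Ordinals and cardinals *)

(** The levels of [X] are stretched. As [alpha] has at most [lambda] predecessors, some
    [th <= lambda] is mapped cofinally into [alpha] by a strictly increasing continuous [sg]
    ([cofinal_sequence]). The first [th] levels of [X] serve as a skeleton ([space_system_good]).
    The gap from [sg b] to [sg (osucc b)] has a length [gam b < alpha], so induction yields a good
    space of that height to fill it.

    For [x] of level [osucc b], admissibility says that tails of [omega1] many disjoint cones, with
    [x] added, form a basis at [x]. So [x] sits over its cones as infinity sits over a discrete set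
    of size [omega1]. A good [S] has [omega1] isolated points too, and goodness makes the infinity
    of its one-point Lindelofication a point of rank exactly [gam b] ([one_point_system]). Matching
    isolated points with cones inserts this space below [x] ([insertion_exists]).

    The result is locally Lindelof, Hausdorff and a P-space because the projection to [X] is
    continuous ([hat_open]) and preimages of basic sets are Lindelof by induction on rank
    ([hat_lindelof]); see [substitution_system]. It is good because basic sets project into
    countable unions of cones of [X] ([projection_covered], [substitution_good]), and its levels
    stay small by [card_bigcup_omega1].

    All this is done with neighbourhood bases and an explicit rank; [cone_basis] extracts such data
    from a space, and [system_space_LLSP] returns to spaces. *)

HB.instance Definition _ := isPointed.Build ord ord_zero.

Lemma choice_on (I U : Type) (u0 : U) (D : set I) (P : I -> U -> Prop) :
  (forall i, D i -> exists u, P i u) -> exists f, forall i, D i -> P i (f i).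
Proof.
move=> DP; have [|f fP] := @choice I U (fun i u => D i -> P i u).
  move=> i; have [/DP[u Pu]|nDi] := pselect (D i); first by exists u.
  by exists u0.
by exists f.
Qed.

Lemma card_le_inj (T U : Type) (f : T -> U) (A : set T) (B : set U) :
  (forall x, A x -> B (f x)) ->
  (forall x y, A x -> A y -> f x = f y -> x = y) -> A #<= B.
Proof.
move=> fAB f_inj; suff [g] : $|{injfun A >-> B}| by exact: inj_card_le g.
apply/injfunPex; exists f => // x y /set_mem Ax /set_mem Ay.
exact: f_inj.
Qed.

Lemma card_le_injP (T : Type) (U : pointedType) (A : set T) (B : set U) :
  A #<= B <-> exists2 f : T -> U, (forall x, A x -> B (f x)) &
    forall x y, A x -> A y -> f x = f y -> x = y.
Proof.
split=> [/pcard_leP/injfunPex[f fAB f_inj]|[f]]; last exact: card_le_inj.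
by exists f => // x y Ax Ay; apply: f_inj; exact: mem_set.
Qed.

(** Diagonal argument: [P] collects the values [f A] lying outside [A], and injectivity makes
    [P (f P)] equivalent to its negation. *)
Lemma Cantor_bool (T : Type) (f : (T -> bool) -> T) : ~ injective f.
Proof.
move=> f_inj; pose P t := `[< exists2 A, t = f A & ~~ A t >].
have [/[dup] PfP /asboolP[A /f_inj <-]|nPfP] := boolP (P (f P)).
  by rewrite PfP.
by move/asboolP: (nPfP); apply; exists P.
Qed.

Lemma least_le (P : set ord) a : P a -> least P <= a.
Proof. by move=> Pa; have [|_ /(_ a Pa)] := @leastP P; first by exists a. Qed.

Lemma lt_osucc a : a < osucc a.
Proof.
have [|//] := @leastP [set b | a < b].
by have [b ab] := ord_strict_ub (fun _ : unit => a); exists b; exact: ab tt.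
Qed.

Lemma osucc_le a b : (osucc a <= b) = (a < b).
Proof.
apply/idP/idP => [|ab]; first exact: lt_le_trans (lt_osucc a).
exact: least_le.
Qed.

Lemma lt_osuccE a b : (a < osucc b) = (a <= b).
Proof. by rewrite ltNge osucc_le -leNgt. Qed.

Lemma ord_wlt0 a : (a < ord_zero) = false.
Proof. by rewrite ltNge ord_zero_le. Qed.

Lemma osucc_inj : injective osucc.
Proof.
move=> a b ab; apply/le_anti/andP.
by rewrite -!lt_osuccE -ab lt_osucc ab lt_osucc.
Qed.

(** The nodes strictly below the root of the tree [s]: [None] stands for a child itself, [Some] for
    a node below it. Being built from the index types of [s], this type is small, so [ord_strict_ub]
    applies to families over it. *)
Fixpoint code_index (s : ord_code) : Type :=
  let: OrdSup A f := s in {x : A & option (code_index (f x))}.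

Fixpoint code_elem (s : ord_code) : code_index s -> ord_code :=
  match s with
  | OrdSup A f => fun p =>
      match p with existT x o => if o is Some y then code_elem y else f x end
  end.

Lemma code_elem_surj s t : code_lt t s ->
  exists i : code_index s, code_eqv t (code_elem i).
Proof.
elim: s t => A f IH t [x tfx].
have [fxt|/IH[i ti]] := code_le_total (f x) t.
  by exists (existT _ x None); apply/asboolP.
by exists (existT _ x (Some i)).
Qed.

(* A proper initial segment of [ord] is small although [ord] is not. *)
Lemma ord_ub_below a (f : ord -> ord) : exists b, forall c, c < a -> f c < b.
Proof.
have [b fb] := ord_strict_ub
  (fun i : code_index (repr a) => f (\pi_ord (code_elem i))).
exists b => c; rewrite -[c in c < a]reprK -[a in _ < a]reprK ord_ltE => /asboolP.
move=> /code_elem_surj[i ci]; suff -> : c = \pi_ord (code_elem i) by [].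
by rewrite -[LHS]reprK; apply/eqmodP.
Qed.

(** * Transfinite recursion and ordinal addition *)

Section TransfiniteRecursion.
Variables (a : ord) (k : ord -> ord -> ord).

(** The supremum of [a] and of all [k eta (orec eta)] with [eta < xi], with no split into successors
    and limits. It yields addition, the blocks of [bigcup_countable_omega1], and the map [sg] of
    [cofinal_sequence]. *)
Definition orec : ord -> ord := Fix ord_lt_wf (fun=> ord) (fun xi rec =>
  least [set b | a <= b /\ forall eta (h : eta < xi), k eta (rec eta h) <= b]).

Lemma orecE xi : orec xi =
  least [set b | a <= b /\ forall eta, eta < xi -> k eta (orec eta) <= b].
Proof.
rewrite /orec Fix_eq // => {}xi f g fg; congr least; apply/seteqP.
by split=> b /= [ab h]; split=> // eta h'; [rewrite -fg|rewrite fg]; exact: h.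
Qed.

Lemma orecP xi :
  a <= orec xi /\ forall eta, eta < xi -> k eta (orec eta) <= orec xi.
Proof.
rewrite orecE; set P := [set b | _]; suff /leastP[] : P !=set0 by [].
have [b kb] := ord_ub_below xi (fun eta => k eta (orec eta)).
exists (Order.max a b); split=> [|eta /kb /ltW]; rewrite le_max ?lexx //.
by move=> ->; rewrite orbT.
Qed.

Lemma lt_orec xi c : c < orec xi ->
  c < a \/ exists2 eta, eta < xi & c < k eta (orec eta).
Proof.
move=> c_lt; have [|] := boolP (c < a); first by left.
rewrite -leNgt => ac; right; apply: contrapT => nex.
move: c_lt; rewrite ltNge orecE => /negP; apply; apply: least_le.
split=> // eta eta_xi; rewrite leNgt; apply/negP => c_lt.
by apply: nex; exists eta.
Qed.

End TransfiniteRecursion.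

Definition oadd a d := orec a (fun _ v => osucc v) d.

Lemma le_oadd a d : a <= oadd a d.
Proof. exact: (orecP _ _ _).1. Qed.

Lemma oadd_lt a d d' : d < d' -> oadd a d < oadd a d'.
Proof.
move=> dd'; rewrite -osucc_le.
exact: (orecP a (fun _ v => osucc v) d').2 _ dd'.
Qed.

Lemma oadd_le a d d' : (oadd a d <= oadd a d') = (d <= d').
Proof.
apply/idP/idP; last by rewrite !le_eqVlt => /predU1P[->|/oadd_lt ->];
  rewrite ?eqxx ?orbT.
by apply: contraTT; rewrite -!ltNge => /oadd_lt.
Qed.

Lemma oadd_inj a : injective (oadd a).
Proof.
by move=> d d' dd'; apply/le_anti/andP; split; rewrite -(oadd_le a) dd' lexx.
Qed.

Lemma lt_oadd a d c : c < oadd a d -> c < a \/ exists2 d', d' < d & c <= oadd a d'.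
Proof.
move=> /lt_orec[|[d' d'd]]; first by left.
by rewrite lt_osuccE => ?; right; exists d'.
Qed.

Lemma oadd0 a : oadd a ord_zero = a.
Proof.
apply/le_anti; rewrite le_oadd andbT leNgt; apply/negP => /lt_oadd[|[d]].
  by rewrite ltxx.
by rewrite ord_wlt0.
Qed.

(** The least [d] with [e <= oadd a d] gives equality: otherwise [lt_oadd] and [a <= e] would
    produce a smaller one. *)
Lemma oadd_between a c e : a <= e -> e < oadd a c ->
  exists2 d, d < c & e = oadd a d.
Proof.
move=> ae e_lt; have [|/= ed dmin] := @leastP [set d | e <= oadd a d].
  by exists c; exact: ltW.
set d := least _ in ed dmin; have eE : e = oadd a d.
  apply/le_anti; rewrite ed leNgt; apply/negP => /lt_oadd[|[d' d'd /dmin]].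
    by rewrite ltNge ae.
  by rewrite leNgt d'd.
by exists d => //; rewrite ltNge -(oadd_le a) -eE -ltNge.
Qed.

Lemma oadd_ge a d : d <= oadd a d.
Proof.
elim/(well_founded_ind ord_lt_wf): d => d IH.
by rewrite leNgt; apply/negP => dlt; have := IH _ dlt; rewrite oadd_le leNgt dlt.
Qed.

Lemma oadd_sub a b : a <= b -> exists c, b = oadd a c.
Proof.
move=> ab; have [||c] := @oadd_between a (osucc b) b; rewrite ?ab //.
  by apply: lt_le_trans (oadd_ge _ _); exact: lt_osucc.
by move=> _ ->; exists c.
Qed.

(** * Enumeration of small types by ordinals *)

Section SmallEnumeration.
Variables (T : Type) (t0 : T).

Let enum : ord -> {classic T} := Fix ord_lt_wf (fun=> {classic T})
  (fun a rec => xget (t0 : {classic T})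
    (~` [set t | exists b (h : b < a), rec b h = t])).

Let enumE a : enum a =
  xget (t0 : {classic T}) (~` [set t | exists2 b, b < a & enum b = t]).
Proof.
rewrite /enum Fix_eq; last first.
  move=> {}a f g fg; congr xget; congr setC; apply/seteqP.
  by split=> t /= [b [h <-]]; exists b, h; rewrite fg.
by congr xget; congr setC; apply/seteqP; split=> t /= [b];
  [move=> [h <-]; exists b|move=> h <-; exists b, h].
Qed.

(* Keep choosing new elements of [T]; this must stop since [ord] does not    *)
(* inject into a small type.                                                 *)
Lemma ord_enum : exists e (g : ord -> T) (h : T -> ord),
  [/\ forall a b, a < e -> b < e -> g a = g b -> a = b,
      forall t, h t < e & cancel h g].
Proof.
pose exhausted a := forall t, exists2 b, b < a & enum b = t.
have new a : ~ exhausted a -> forall b, b < a -> enum a <> enum b.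
  move=> /existsNP[t nt] b ba eqab.
  have := @xgetPex _ (t0 : {classic T})
    (~` [set t | exists2 b, b < a & enum b = t]) (ex_intro _ t nt).
  by apply; rewrite -enumE; exists b.
have inj (Q : set ord) : (forall a, Q a -> ~ exhausted a) ->
    forall a b, Q a -> Q b -> enum a = enum b -> a = b.
  move=> nQ a b Qa Qb eqab; apply: contrapT => /eqP.
  case: ltgtP => // [ab|ba] _.
    by apply: (new _ (nQ _ Qb) _ ab); rewrite eqab.
  by apply: (new _ (nQ _ Qa) _ ba); rewrite eqab.
have [exh|nexh] := pselect (exists a, exhausted a).
  have [full lb] := @leastP exhausted exh.
  have [|h hP] := @choice_on _ _ ord_zero setT
      (fun t a => a < least exhausted /\ enum a = t).
    by move=> t _; have [a] := full t; exists a.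
  exists (least exhausted), enum, h; split=> [|t|t]; try by have [] := hP t I.
  apply: (inj [set a | a < _]).
  by move=> a /= a_lt /lb; rewrite leNgt a_lt.
have einj a b : enum a = enum b -> a = b.
  by apply: (inj setT) => // c _ exhc; apply: nexh; exists c.
have [e eub] := ord_strict_ub (fun t : T => xget ord_zero [set a | enum a = t]).
have := eub (enum e); rewrite (_ : xget _ _ = e) ?ltxx //.
by apply: einj; exact: (@xgetPex _ ord_zero [set a | enum a = enum e])
  (ex_intro _ e erefl).
Qed.

End SmallEnumeration.

(** * The cardinals [omega1] and [omega2] *)

Lemma omega1_nonempty : [set a | ~ countable (below a)] !=set0.
Proof.
have [e [g [h [g_inj h_lt hK]]]] := @ord_enum (nat -> bool) xpred0.
exists e => /countable_injP[f f_inj]; apply: (@Cantor_bool nat (f \o h)) => A B.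
move=> /f_inj; rewrite !inE => /(_ (h_lt A) (h_lt B)).
exact: can_inj hK A B.
Qed.

Lemma omega1_uncountable : ~ countable (below omega1).
Proof. exact: (leastP omega1_nonempty).1. Qed.

Lemma countable_below a : countable (below a) <-> a < omega1.
Proof.
split=> [ca|a_lt].
  rewrite ltNge; apply/negP => a_ge; apply: omega1_uncountable.
  apply: sub_countable ca; apply: subset_card_le => b /= b_lt.
  exact: lt_le_trans a_ge.
apply: contrapT => /(leastP omega1_nonempty).2.
by rewrite -/omega1 leNgt a_lt.
Qed.

(** Regularity of [omega1]: the union [S] of the closed initial segments ending in [C] is countable,
    so the least ordinal outside [S] exists and has countably many predecessors. *)
Lemma countable_bound_omega1 (C : set ord) : countable C ->
  C `<=` below omega1 -> exists2 b, b < omega1 & forall c, C c -> c < b.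
Proof.
move=> cC C_lt; pose S := \bigcup_(c in C) below (osucc c).
have cS : countable S.
  apply: bigcup_countable => // c /C_lt /countable_below cc.
  rewrite (_ : below (osucc c) = below c `|` [set c]); last first.
    apply/seteqP; split=> b; rewrite /below /= lt_osuccE le_eqVlt.
      by move=> /predU1P[->|]; [right|left].
    by case=> [->|->]; rewrite ?eqxx ?orbT.
  rewrite -bigcup2E; apply: bigcup_countable => // -[|[|i]] _ //=.
have ubS : exists b, ~ S b.
  apply: contrapT => /forallNP allS; apply: omega1_uncountable.
  apply: sub_countable cS; apply: subset_card_le => b _.
  exact: contrapT (allS b).
have [nSb bmin] := leastP ubS; set b := least _ in nSb bmin.
exists b.
  apply/countable_below; apply: sub_countable cS; apply: subset_card_le => c.
  rewrite /below /= => cb; apply: contrapT => /bmin; rewrite leNgt cb //.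
move=> c Cc; rewrite ltNge; apply/negP => bc; apply: nSb; exists c => //.
by rewrite /below /= lt_osuccE.
Qed.

Lemma osucc_lt_omega1 a : a < omega1 -> osucc a < omega1.
Proof.
move=> a_lt; have [||b b_lt ab] := @countable_bound_omega1 [set a].
- exact: countable1.
- by move=> _ ->.
- by apply: le_lt_trans b_lt; rewrite osucc_le; exact: ab.
Qed.

Lemma ord_zero_lt_omega1 : ord_zero < omega1.
Proof.
apply/countable_below; rewrite (_ : below _ = set0) //.
by apply/seteqP; split=> b //; rewrite /below /= ord_wlt0.
Qed.

Lemma omega1_cardinal : is_cardinal omega1.
Proof.
move=> a /countable_below ca; apply/negP => /eq_countable eqc.
by apply: omega1_uncountable; rewrite -eqc.
Qed.

Lemma cardinal_of a : exists k, [/\ is_cardinal k, k <= a & below k #= below a].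
Proof.
have [|/= eqk kmin] := @leastP [set k | below k #= below a].
  by exists a; exact: card_eqxx.
set k := least _ in eqk kmin; exists k; split=> //; last exact: kmin (card_eqxx _).
move=> b bk; apply/negP => eqb; have := kmin b (card_eq_trans eqb eqk).
by rewrite leNgt bk.
Qed.

(** Since [least] of an empty set is [ord_zero], a cardinal above [omega1] must be exhibited. The
    cardinality of the double power set of [nat] serves: [omega1] is at most an ordinal [e1]
    enumerating the power set, and Cantor applies once more. *)
Lemma omega1_lt_omega2 : omega1 < omega2.
Proof.
have [|[_ lt_om] _] := @leastP [set m | is_cardinal m /\ omega1 < m];
  last exact: lt_om.
have [e1 [g1 [h1 [g1_inj h1_lt h1K]]]] := @ord_enum (nat -> bool) xpred0.
have [e2 [g2 [h2 [_ h2_lt h2K]]]] := @ord_enum ((nat -> bool) -> bool) xpred0.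
have e1_ge : omega1 <= e1.
  rewrite leNgt; apply/negP => /countable_below/countable_injP[f f_inj].
  apply: (@Cantor_bool nat (f \o h1)) => A B.
  move=> /f_inj; rewrite !inE => /(_ (h1_lt A) (h1_lt B)).
  exact: can_inj h1K A B.
have [k [k_card _ eqk]] := cardinal_of e2.
exists k; split=> //; rewrite ltNge; apply/negP => k_le.
have : below e2 #<= below k by move/card_eqPle: eqk => [].
move=> /card_le_injP[f f_k f_inj].
have f_lt A : f (h2 A) < e1.
  by apply: lt_le_trans e1_ge; apply: lt_le_trans k_le; exact: f_k (h2_lt A).
apply: (@Cantor_bool (nat -> bool) (g1 \o f \o h2)) => A B.
move=> /(g1_inj _ _ (f_lt A) (f_lt B)) /(f_inj _ _ (h2_lt A) (h2_lt B)).
exact: can_inj h2K A B.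
Qed.

(** Hilbert's hotel: were [k = osucc a], sending [a] to zero, shifting the finite ordinals by one
    and fixing the rest would inject [below k] into [below a]. *)
Lemma cardinal_limit k : is_cardinal k -> omega1 < k ->
  forall a, a < k -> osucc a < k.
Proof.
move=> k_card k_gt a ak; rewrite ltNge; apply/negP => k_le.
have kE : k = osucc a by apply/le_anti; rewrite k_le osucc_le ak.
have /negP := k_card a ak; apply; apply/card_eqPle; split.
  by apply: subset_card_le => b; rewrite /below /= => /lt_trans; exact.
have om_a : omega1 <= a by move: k_gt; rewrite kE lt_osuccE.
pose fin b := exists n : nat, b = iter n osucc ord_zero.
have fin_lt b : fin b -> b < omega1.
  move=> [n ->]; elim: n => [|n IH]; first exact: ord_zero_lt_omega1.
  exact: osucc_lt_omega1.
have fin0 : fin ord_zero by exists 0%N.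
have finS b : fin b -> fin (osucc b) by move=> [n ->]; exists n.+1.
have nfina : ~ fin a by move=> /fin_lt; rewrite ltNge om_a.
pose phi b := if b == a then ord_zero else if `[< fin b >] then osucc b else b.
have phiS b : fin b -> phi b = osucc b.
  by rewrite /phi; case: eqP => [->//|_ fb]; case: asboolP.
have phiI b : ~ fin b -> b != a -> phi b = b.
  by rewrite /phi => nf /negbTE ->; case: asboolP.
have phia : phi a = ord_zero by rewrite /phi eqxx.
have succ_neq0 b : osucc b <> ord_zero.
  by move=> b0; have := lt_osucc b; rewrite b0 ord_wlt0.
have phi_fin b : b <> a -> fin (phi b) -> fin b.
  by move=> /eqP ba fb; apply: contrapT => nf; apply: (nf); rewrite -(phiI b).
apply/card_le_injP; exists phi => [b|b c _ _].
  rewrite /below /= kE lt_osuccE le_eqVlt => /predU1P[->|ba].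
    by rewrite phia (lt_le_trans ord_zero_lt_omega1).
  have [/[dup] fb /phiS ->|nfb] := pselect (fin b).
    by apply: lt_le_trans om_a; apply: osucc_lt_omega1; exact: fin_lt.
  by rewrite phiI ?lt_eqF.
have aux d : phi d = ord_zero -> d = a.
  move=> phid; apply: contrapT => da; have /(phi_fin _ da) : fin (phi d).
    by rewrite phid.
  by move=> /phiS; rewrite phid => /esym/succ_neq0.
have [->|ba] := pselect (b = a); first by rewrite phia => /esym/aux.
have [->|ca] := pselect (c = a); first by rewrite phia => /aux.
have [fb|nfb] := pselect (fin b); have [fc|nfc] := pselect (fin c).
- by rewrite !phiS // => /osucc_inj.
- by rewrite (phiS b) // => pbc; case: nfc; apply: phi_fin => //; rewrite -pbc; exact: finS.
- by rewrite (phiS c) // => pbc; case: nfb; apply: phi_fin => //; rewrite pbc; exact: finS.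
- by rewrite !phiI //; exact/eqP.
Qed.

Lemma disjoint_elim (T : Type) (A B : set T) x : A `&` B = set0 -> A x -> ~ B x.
Proof. by move=> AB0 Ax Bx; have : (A `&` B) x by []; rewrite AB0. Qed.

Lemma orec_le a k xi b : a <= b ->
  (forall eta, eta < xi -> k eta (orec a k eta) <= b) -> orec a k xi <= b.
Proof.
move=> ab kb; rewrite leNgt; apply/negP => /lt_orec[|[eta /kb]].
  by rewrite ltNge ab.
by rewrite leNgt => /negbTE ->.
Qed.

(** * Unions of [omega1] many sets *)

Lemma iter_osucc_le n a : a <= iter n osucc a.
Proof.
by elim: n => //= n IH; apply: le_trans IH _; rewrite ltW // lt_osucc.
Qed.

Lemma iter_osucc_inj a : injective (fun n => iter n osucc a).
Proof.
have mono n m : (n < m)%N -> iter n osucc a < iter m osucc a.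
  move=> /subnK <-; rewrite iterD.
  exact: lt_le_trans (lt_osucc _) (iter_osucc_le _ _).
by move=> n m /= eqnm; case: (ltngtP n m) => // /mono; rewrite eqnm ltxx.
Qed.

(** Here [jump v] is v + omega and [G nu] is omega times nu, so the finite successors of the various
    [G nu] form disjoint blocks. A point goes into the block of the first [K nu] containing it, at
    its place in an enumeration of that set. *)
Lemma bigcup_countable_omega1 (T : Type) (K : ord -> set T) :
  (forall nu, nu < omega1 -> countable (K nu)) ->
  \bigcup_(nu in below omega1) K nu #<= below omega1.
Proof.
move=> cK; pose jump v := least [set e | forall n, iter n osucc v < e].
have jumpP v n : iter n osucc v < jump v.
  by have [|/= + _] := @leastP [set e | forall n, iter n osucc v < e];
    [have [b ?] := ord_strict_ub (fun n => iter n osucc v); exists b|exact].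
have iter_lt v n : v < omega1 -> iter n osucc v < omega1.
  by move=> v_lt; elim: n => //= n; exact: osucc_lt_omega1.
have jump_lt v : v < omega1 -> jump v < omega1.
  move=> v_lt; have [|_ [n _ <-]|b b_lt vb] :=
    @countable_bound_omega1 (range (fun n => iter n osucc v)).
  - exact: sub_countable (card_image_le _ _) _.
  - exact: iter_lt.
  apply: le_lt_trans b_lt; apply: least_le => n /=.
  by apply: vb; exists n.
pose G := orec ord_zero (fun=> jump).
have G_lt nu : nu < omega1 -> G nu < omega1.
  elim/(well_founded_ind ord_lt_wf): nu => nu IH nu_lt.
  have [||b b_lt Gb] := @countable_bound_omega1 ((jump \o G) @` below nu).
  - exact: sub_countable (card_image_le _ _) (iffRL (countable_below _) nu_lt).
  - move=> _ [eta eta_nu <-]; apply: jump_lt; apply: IH => //.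
    exact: lt_trans nu_lt.
  apply: le_lt_trans b_lt; apply: orec_le => [|eta eta_nu].
    exact: ord_zero_le.
  by apply: ltW; apply: Gb; exists eta.
have [c c_inj] := @choice_on _ _ (fun _ : T => 0%N) _ _
  (fun nu nu_lt => elimT (countable_injP _) (cK nu nu_lt)).
pose idx y := least [set nu | K nu y].
have idxP y nu : nu < omega1 -> K nu y -> idx y < omega1 /\ K (idx y) y.
  move=> nu_lt Knu; have [|Ky _] := @leastP [set nu | K nu y].
    by exists nu.
  by split=> //; apply: le_lt_trans nu_lt; exact: least_le.
pose phi y := iter (c (idx y) y) osucc (G (idx y)).
have phi_lt y z : idx y < idx z -> phi y < phi z.
  move=> yz; apply: lt_le_trans (iter_osucc_le _ _).
  by apply: lt_le_trans ((orecP ord_zero (fun=> jump) _).2 _ yz); exact: jumpP.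
apply/card_le_injP; exists phi => [y [nu nu_lt Ky]|y z [nu nu_lt Ky] [mu mu_lt Kz]].
  by apply: iter_lt; apply: G_lt; exact: (idxP _ _ nu_lt Ky).1.
move=> phiE; have idxE : idx y = idx z.
  by apply/eqP; case: ltgtP => // /phi_lt; rewrite phiE ltxx.
have [y_lt Kiy] := idxP _ _ nu_lt Ky; have [z_lt Kiz] := idxP _ _ mu_lt Kz.
apply: (c_inj _ y_lt); rewrite ?inE //; first by rewrite idxE.
apply: (@iter_osucc_inj (G (idx y))); move: phiE; rewrite /phi.
by rewrite -idxE.
Qed.

(** The square of [omega1] is stratified by the maximum of the two coordinates: [K nu] has both at
    most [nu], hence is countable. *)
Lemma card_bigcup_omega1 (I T : Type) (A : set I) (F : I -> set T) :
  A #<= below omega1 -> (forall i, A i -> F i #<= below omega1) ->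
  \bigcup_(i in A) F i #<= below omega1.
Proof.
move=> /card_le_injP[h h_lt h_inj] F_le.
have [|g gP] := @choice_on _ _ (fun _ : T => ord_zero) A (fun i g =>
    (forall y, F i y -> g y < omega1) /\
    (forall y z, F i y -> F i z -> g y = g z -> y = z)).
  by move=> i /F_le/card_le_injP[f f_lt f_inj]; exists f.
pose K nu := \bigcup_(i in [set i | A i /\ h i <= nu])
  [set y | F i y /\ g i y <= nu].
apply: (@card_le_trans _ _ _ (\bigcup_(nu in below omega1) K nu)).
  apply: subset_card_le => y [i Ai Fy]; have [g_lt g_inj] := gP i Ai.
  exists (Order.max (h i) (g i y)); last first.
    by exists i; split; rewrite // le_max lexx ?orbT.
  by rewrite /below /= gt_max h_lt //= g_lt.
apply: bigcup_countable_omega1 => nu /osucc_lt_omega1/countable_below cnu.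
apply: bigcup_countable => [|i [Ai _]].
  apply: sub_countable cnu; apply/card_le_injP; exists h => [i|i j] [Ai hi].
    by rewrite /below /= lt_osuccE.
  by move=> [Aj _]; exact: h_inj.
have [g_lt g_inj] := gP i Ai.
apply: sub_countable cnu; apply/card_le_injP; exists (g i) => [y|y z] [Fy gy].
  by rewrite /below /= lt_osuccE.
by move=> [Fz _]; exact: g_inj.
Qed.

(** * Systems of cones *)

Section CountableCover.
Variable T : Type.
Implicit Types (A B : set T) (V F : set (set T)).

Definition countably_covered V A := exists F,
  [/\ F `<=` V, countable F & A `<=` \bigcup_(W in F) W].

Lemma ccov_sub V A B : A `<=` B -> countably_covered V B ->
  countably_covered V A.
Proof. by move=> AB [F [FV cF BF]]; exists F; split=> // x /AB/BF. Qed.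

Lemma ccov1 V A W : V W -> A `<=` W -> countably_covered V A.
Proof.
move=> VW AW; exists [set W]; split=> [_ -> //||x /AW Wx]; last by exists W.
exact: countable1.
Qed.

(** This drives the Lindelof proofs for the spaces built below: [ls_lindelof] is applied to the
    family of all sets already known to be countably covered, and the countably many covers are then
    united. *)
Lemma ccov_bigcup (I : Type) (D : set I) (f : I -> set T) V A : countable D ->
  (forall i, D i -> countably_covered V (f i)) ->
  A `<=` \bigcup_(i in D) f i -> countably_covered V A.
Proof.
move=> cD fV Af; have [G GP] := choice_on set0 fV.
exists (\bigcup_(i in D) G i); split=> [W [i Di]||x /Af[i Di fx]].
- by have [+ _ _] := GP i Di; apply.
- by apply: bigcup_countable => // i Di; have [] := GP i Di.
- by have [_ _ /(_ x fx)[W GW Wx]] := GP i Di; exists W => //; exists i.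
Qed.

Lemma ccovU V A B : countably_covered V A -> countably_covered V B ->
  countably_covered V (A `|` B).
Proof.
move=> VA VB; apply: (@ccov_bigcup bool setT (fun b => if b then A else B)) => //.
  by case.
by move=> x [Ax|Bx]; [exists true|exists false].
Qed.

Lemma ccov_trans V V' A : countably_covered V' A ->
  (forall W, V' W -> countably_covered V W) -> countably_covered V A.
Proof.
move=> [F [FV' cF AF]] V'V; apply: (ccov_bigcup cF _ AF) => W /FV'.
exact: V'V.
Qed.

End CountableCover.

(* A scattered space presented by basic neighbourhoods that are cones, with   *)
(* the rank function as part of the data. The space is [domain]; [bas] and    *)
(* [rank] are junk elsewhere.                                                 *)
Record system := System {
  point_of : Type;
  domain : set point_of;
  bas : point_of -> set (set point_of);
  rank : point_of -> ord }.
Arguments domain : clear implicits.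

(** [ls_cap] gives both a neighbourhood basis and the P-space property; with [F] empty it makes
    [bas x] inhabited. In [ls_lindelof] the members of [V] need not be open: each point only needs a
    basic neighbourhood inside one of them. [ls_cone] and [ls_cofinal] force [rank] to be the
    Cantor-Bendixson level. *)
Record LLSP_system (S : system) : Prop := LLSPSystem {
  ls_mem : forall x A, domain S x -> bas x A -> A x;
  ls_sub : forall x A, domain S x -> bas x A -> A `<=` domain S;
  ls_open : forall x A y, domain S x -> bas x A -> A y ->
    exists2 A', bas y A' & A' `<=` A;
  ls_cap : forall x (F : set (set (point_of S))), domain S x -> countable F ->
    F `<=` bas x -> exists2 A', bas x A' & forall A, F A -> A' `<=` A;
  ls_sep : forall x y, domain S x -> domain S y -> x <> y ->
    exists A A', [/\ bas x A, bas y A' & A `&` A' = set0];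
  ls_lindelof : forall x A V, domain S x -> bas x A ->
    (forall y, A y -> exists W A', [/\ V W, bas y A' & A' `<=` W]) ->
    countably_covered V A;
  ls_cone : forall x A y, domain S x -> bas x A -> A y -> y <> x ->
    rank y < rank x;
  ls_cofinal : forall x A c, domain S x -> bas x A -> c < rank x ->
    exists y, [/\ A y, y <> x & c <= rank y] }.

Definition basic (S : system) := \bigcup_(x in domain S) @bas S x.

Arguments basic : clear implicits.

Definition level (S : system) (e : ord) :=
  [set x | domain S x /\ rank x = e].

Arguments level : clear implicits.

(** Goodness is tested on basic sets only. By [gs_lt] and [gs_good] the height is exactly [g];
    [gs_width] and [gs_level0] provide the bijection of [level0_enum] between isolated points and
    [omega1]. *)
Record good_system (g : ord) (S : system) : Prop := GoodSystem {
  gs_sys : LLSP_system S;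
  gs_lt : forall x, domain S x -> rank x < g;
  gs_good : forall e F, e < g -> countable F -> F `<=` basic S ->
    ~ countable (level S e `\` \bigcup_(A in F) A);
  gs_width : forall e, level S e #<= below omega1;
  gs_level0 : below omega1 #<= level S ord_zero }.

Section SystemTheory.
Variables (S : system) (SP : LLSP_system S).
Local Notation D := (domain S).
Implicit Types x y : point_of S.

Lemma ls_ex x : D x -> exists A, bas x A.
Proof.
by move=> Dx; have [|A] := ls_cap SP Dx (countable0 _); [|exists A].
Qed.

Lemma ls_cap_fam x (I : Type) (J : set I) (f : I -> set (point_of S)) : D x ->
  countable J -> (forall i, J i -> exists2 A, bas x A & A `<=` f i) ->
  exists2 A, bas x A & forall i, J i -> A `<=` f i.
Proof.
move=> Dx cJ fP; have [|h hP] := @choice_on _ _ set0 J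
  (fun i A => bas x A /\ A `<=` f i); first by move=> i /fP[A]; exists A.
have [||A xA Ah] := @ls_cap _ SP x (h @` J) Dx.
- exact: sub_countable (card_image_le _ _) cJ.
- by move=> _ [i Ji <-]; exact: (hP i Ji).1.
exists A => // i Ji; apply: subset_trans (hP i Ji).2.
by apply: Ah; exists i.
Qed.

Lemma ls_avoid x (C : set (point_of S)) : D x -> countable C -> ~ C x ->
  exists2 A, bas x A & A `&` C = set0.
Proof.
move=> Dx cC nCx; have [c Cc|A xA AC] := ls_cap_fam (f := fun c => ~` [set c]) Dx cC.
  have [Dc|nDc] := pselect (D c).
    have [|A [A' [xA cA' AA']]] := ls_sep SP Dx Dc; first by move=> xc; rewrite xc in nCx.
    exists A => // y Ay yc; rewrite yc in Ay.
    exact: (disjoint_elim AA' Ay) (ls_mem SP Dc cA').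
  by have [A xA] := ls_ex Dx; exists A => // y /(ls_sub SP Dx xA) Dy yc; rewrite yc in Dy.
exists A => //; apply/seteqP; split=> // y [Ay Cy]; exact: AC Cy _ Ay _.
Qed.

(** Lindelof sets are closed in a Hausdorff P-space: countably many sets, each missing a
    neighbourhood of [y], cover [A], and those neighbourhoods can be intersected. *)
Lemma ls_closed x A y : D x -> bas x A -> D y -> ~ A y ->
  exists2 A', bas y A' & A `&` A' = set0.
Proof.
move=> Dx xA Dy nAy.
pose V := [set W | exists2 A', bas y A' & W `&` A' = set0].
have [z Az|F [FV cF AF]] := @ls_lindelof _ SP x A V Dx xA.
  have [||B [B' [zB yB' BB']]] := @ls_sep _ SP z y _ Dy.
  - exact: ls_sub xA _ Az.
  - by move=> zy; rewrite zy in Az.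
  by exists B, B; split=> //; exists B'.
have [W FW|A' yA' A'F] := ls_cap_fam (f := fun W => ~` W) Dy cF.
  have [B yB WB] := FV W FW; exists B => // z Bz Wz.
  exact: disjoint_elim WB Wz Bz.
exists A' => //; apply/seteqP; split=> // z [/AF[W FW Wz] A'z].
exact: A'F FW _ A'z Wz.
Qed.

Lemma ls_bas0 x A : D x -> rank x = ord_zero -> bas x A -> A = [set x].
Proof.
move=> Dx x0 xA; apply/seteqP; split=> [y Ay|_ ->]; last exact: ls_mem xA.
apply: contrapT => /(ls_cone SP Dx xA Ay).
by rewrite x0 ord_wlt0.
Qed.

End SystemTheory.

(** * One-point Lindelofication *)

Section OnePoint.
Variables (g : ord) (S : system) (SP : good_system g S).
Let SS := gs_sys SP.

Definition co_basic (F : set (set (point_of S))) : set (option (point_of S)) :=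
  [set o | if o is Some z then domain S z /\ ~ (\bigcup_(A in F) A) z else True].

Definition one_point : system := @System (option (point_of S))
  [set o | if o is Some z then domain S z else True]
  (fun o => if o is Some z then [set Some @` A | A in bas z] else
    [set co_basic F | F in [set F | countable F /\ F `<=` basic S]])
  (fun o => if o is Some z then rank z else g).

(** Removing the empty family leaves everything. Thus the whole one-point extension is a basic set,
    and so Lindelof. *)
Lemma one_point_domain : @bas one_point None (domain one_point).
Proof.
exists set0; first by split=> //; exact: sub0set.
apply/seteqP; split=> -[z|] //=; first by case.
by move=> Dz; split=> // -[].
Qed.

Let miss z F : domain S z -> countable F -> F `<=` basic S ->
  ~ (\bigcup_(A in F) A) z ->
  exists2 A, bas z A & A `&` \bigcup_(A in F) A = set0.
Proof.
move=> Dz cF FS nFz.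
have [A FA|B zB BF] := ls_cap_fam SS (f := fun A => ~` A) Dz cF.
  have [y Dy yA] := FS A FA.
  have [|B zB AB] := ls_closed SS Dy yA Dz; first by move=> Az; apply: nFz; exists A.
  by exists B => // x Bx Ax; exact: disjoint_elim AB Ax Bx.
exists B => //; apply/seteqP; split=> // x [Bx [A FA Ax]]; exact: BF FA _ Bx Ax.
Qed.

Lemma one_point_system : LLSP_system one_point.
Proof.
split.
- move=> [z|] A /= Dz; last by case=> F [cF FS] <-.
  by case=> B zB <-; exists z => //; exact: ls_mem zB.
- move=> [z|] A /= Dz; last by case=> F [cF FS] <- [y|] //= [].
  by case=> B zB <- _ [y By <-] /=; exact: ls_sub zB _ By.
- move=> [z|] A y /= Dz.
    case=> B zB <- [x Bx <-] /=.
    have [C xC CB] := ls_open SS Dz zB Bx.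
    by exists (Some @` C); [exists C|exact: image_subset].
  case=> F [cF FS] <- {A}; case: y => [y|_]; last first.
    by exists (co_basic F) => //; exists F.
  move=> [Dy nFy]; have [B yB BF] := miss Dy cF FS nFy.
  exists (Some @` B); first by exists B.
  move=> _ [x Bx <-]; split; first exact: ls_sub yB _ Bx.
  exact: disjoint_elim BF Bx.
- move=> [z|] F /= Dz cF FS.
    have [W /FS[A zA <-]|A zA AF] :=
      ls_cap_fam SS (f := fun W => Some @^-1` W) Dz cF.
      by exists A => // x Ax; exists x.
    exists (Some @` A); first by exists A.
    by move=> W FW _ [x Ax <-]; exact: AF FW _ Ax.
  have [|h hP] := @choice_on _ _ set0 F (fun W G =>
      [/\ countable G, G `<=` basic S & co_basic G = W]).
    by move=> W /FS[G [cG GS] GW]; exists G.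
  exists (co_basic (\bigcup_(W in F) h W)).
    exists (\bigcup_(W in F) h W) => //; split.
      by apply: bigcup_countable => // W /hP[].
    by move=> A [W /hP[_ + _]]; exact.
  move=> W FW; have [_ _ <-] := hP W FW; move=> [x|] //= [Dx nx]; split=> //.
  by move=> [A hA Ax]; apply: nx; exists A => //; exists W.
- have sepN z : domain S z -> exists A A' : set (option (point_of S)),
      [/\ @bas one_point None A, @bas one_point (Some z) A' & A `&` A' = set0].
    move=> Dz; have [A zA] := ls_ex SS Dz.
    exists (co_basic [set A]), (Some @` A); split; last 1 first.
    - apply/seteqP; split=> // o [/[swap] -[x Ax <-] [_ nx]].
      by case: nx; exists A.
    - exists [set A] => //; split; first exact: countable1.
      by move=> _ ->; exists z.
    - by exists A.
  move=> [x|] [y|] //= Dx Dy xy.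
  + have [|A [A' [xA yA' AA']]] := ls_sep SS Dx Dy; first by move=> xyE; rewrite xyE in xy.
    exists (Some @` A), (Some @` A'); split; [by exists A|by exists A'|].
    apply/seteqP; split=> // _ [[z Az <-] [z' A'z' [zz']]].
    by apply: (disjoint_elim AA' Az); rewrite -zz'.
  + have [A [A' [NA yA' AA']]] := sepN x Dx.
    by exists A', A; split=> //; rewrite setIC.
  + exact: sepN.
- have lindS z A V : domain S z -> bas z A ->
      (forall y, A y -> exists W A', [/\ V W, bas y A' & Some @` A' `<=` W]) ->
      countably_covered V (Some @` A).
    move=> Dz zA AV.
    pose V' := [set B | countably_covered V (Some @` B)].
    have [y /AV[W [A' [VW yA' A'W]]]|G [GV cG AG]] := ls_lindelof SS (V := V') Dz zA.
      by exists A', A'; split=> //; exact: ccov1 VW A'W.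
    apply: (@ccov_bigcup _ _ G (fun B => Some @` B)) => // _ [y /AG[B GB By] <-].
    by exists B => //; exists y.
  move=> [z|] A V /= Dz.
    case=> B zB <- BV; apply: (lindS z) => // y By.
    have [|W [_ [VW [A' yA' <-] A'W]]] := BV (Some y); first by exists y.
    by exists W, A'.
  case=> F [cF FS] <- {A} FV.
  have [//|W [_ [VW [G [cG GS] <-] GW]]] := FV None.
  apply: (@ccov_sub _ _ _ (W `|` \bigcup_(A in G) (co_basic F `&` Some @` A))).
    move=> [y|]; last by left; exact: GW.
    move=> Fy; have [[A GA Ay]|nGy] := pselect ((\bigcup_(A in G) A) y).
      by right; exists A => //; split=> //; exists y.
    by left; apply: GW; split=> //; exact: Fy.1.
  apply: ccovU; first exact: ccov1 VW _.
  apply: (@ccov_bigcup _ _ G (fun A => co_basic F `&` Some @` A)) => //.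
  move=> A /GS[z' Dz' z'A].
  (* [V] only covers [co_basic F]. Adding the removed open set [FF] as one more member covers all of
     [A]; it is discarded again afterwards. *)
  pose FF : set (option (point_of S)) := Some @` \bigcup_(A in F) A.
  have [y Ay|H [HV cH AH]] := @lindS z' A (V `|` [set FF]) Dz' z'A.
    have Dy := ls_sub SS Dz' z'A Ay.
    have [Fy|nFy] := pselect ((\bigcup_(A in F) A) y).
      have [C FC Cy] := Fy; have [t Dt tC] := FS C FC.
      have [C' yC' C'C] := ls_open SS Dt tC Cy.
      exists FF, C'; split=> //; first by right.
      by move=> _ [x /C'C Cx <-]; exists x => //; exists C.
    have [|W' [_ [VW' [A' yA' <-] A'W']]] := FV (Some y); first by [].
    by exists W', A'; split=> //; left.
  exists (H `&` V); split; [by move=> ? []|exact: sub_countable (subset_card_le (@subIsetl _ _ _)) _|].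
  move=> x [Fx /AH[W' HW' W'x]]; exists W' => //; split=> //.
  have [//|W'E] := HV W' HW'; rewrite W'E in W'x.
  by case: W'x Fx => y Fy <- [].
- move=> [z|] A y /= Dz.
    case=> B zB <- [x Bx <-] zx; apply: (ls_cone SS Dz zB Bx) => xz.
    by rewrite xz in zx.
  by case=> F [cF FS] <-; case: y => // y [Dy _] _; exact: gs_lt SP _ Dy.
- move=> [z|] A c /= Dz.
    case=> B zB <- /(ls_cofinal SS Dz zB)[y [By yz cy]].
    by exists (Some y); split=> //; case.
  case=> F [cF FS] <- cg.
  (* Goodness of [S] enters here: every neighbourhood of infinity meets every level below [g]. *)
  have [S0|/set0P[y [[Dy yc] nFy]]] := eqVneq (level S c `\` \bigcup_(A in F) A) set0.
    by case: (gs_good SP cg cF FS); rewrite S0.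
  by exists (Some y); rewrite yc.
Qed.

End OnePoint.

Definition is_succ (a : ord) := exists b, osucc b = a.
Definition opred (a : ord) := xget ord_zero [set b | osucc b = a].

Lemma osucc_opred a : is_succ a -> osucc (opred a) = a.
Proof. exact: (@xgetPex _ ord_zero [set b | osucc b = a]). Qed.

Lemma osuccK a : opred (osucc a) = a.
Proof. by apply: osucc_inj; apply: osucc_opred; exists a. Qed.

Lemma oadd_gt a d : ord_zero < d -> a < oadd a d.
Proof. by move=> /(oadd_lt a); rewrite oadd0. Qed.

Lemma ord_zero_lt a : (ord_zero < a) = (a != ord_zero).
Proof. by rewrite lt_neqAle ord_zero_le andbT eq_sym. Qed.

Lemma ccov0 (T : Type) (V : set (set T)) A : A = set0 -> countably_covered V A.
Proof. by move=> ->; exists set0; split=> //; exact: sub0set. Qed.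

Lemma rank_ind (S : system) (P : point_of S -> Prop) :
  (forall x, (forall y, rank y < rank x -> P y) -> P x) -> forall x, P x.
Proof.
move=> IH x; have [a xa] : exists a, rank x = a by exists (rank x).
elim/(well_founded_ind ord_lt_wf): a x xa => a IHa x xa; apply: IH => y yx.
by apply: (IHa (rank y)); rewrite -?xa.
Qed.

(** * Substituting systems into a system *)

Section Substitution.
Variables (X : system) (XP : LLSP_system X).
Local Notation PX := (point_of X).
Let succ (x : PX) := is_succ (rank x).
(** At a point [x] of successor rank, [Z x] is inserted with its greatest point [t x] in the place
    of [x]; a point [z] of rank zero in [Z x] is identified with [u x z], one level below [x], whose
    cone is [U x z]. At other [x] the value [t x] is only a placeholder. *)
Variables (Z : PX -> system) (t : forall x : PX, point_of (Z x)).
Variables (U : forall x : PX, point_of (Z x) -> set PX)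
  (u : forall x : PX, point_of (Z x) -> PX).
Arguments U : clear implicits.
Arguments u : clear implicits.
Arguments t : clear implicits.
Local Notation D := (domain X).
Local Notation base x := (level (Z x) ord_zero).

Hypothesis ZP : forall x, D x -> succ x -> LLSP_system (Z x).
Hypothesis t_dom : forall x, D x -> succ x -> domain (Z x) (t x).
Hypothesis t_bas : forall x, D x -> succ x -> bas (t x) (domain (Z x)).
Hypothesis t_gt0 : forall x, D x -> succ x -> ord_zero < rank (t x).
Hypothesis u_dom : forall x z, D x -> succ x -> base x z -> D (u x z).
Hypothesis u_rank : forall x z, D x -> succ x -> base x z ->
  osucc (rank (u x z)) = rank x.
Hypothesis U_bas : forall x z, D x -> succ x -> base x z ->
  bas (u x z) (U x z).
Hypothesis U_disj : forall x z z', D x -> succ x -> base x z -> base x z' ->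
  z <> z' -> U x z `&` U x z' = set0.
Hypothesis U_inside : forall x A, D x -> succ x -> bas x A ->
  countable [set z | base x z /\ ~ U x z `<=` A].
Hypothesis U_tail : forall x C, D x -> succ x -> countable C ->
  exists2 A, bas x A &
    A `<=` [set x] `|` \bigcup_(z in base x `\` C) U x z.

Variable sg : ord -> ord.
Hypothesis sg_lt : forall a b, a < b -> sg a < sg b.
Hypothesis sg_succ : forall x, D x -> succ x ->
  sg (rank x) = oadd (sg (opred (rank x))) (rank (t x)).
Hypothesis sg_lim : forall a c, ~ is_succ a -> c < sg a ->
  exists2 b, b < a & c <= sg b.

Let Y := {x : PX & point_of (Z x)}.
Let mk x z : Y := existT (fun x => point_of (Z x)) x z.

(** Points of rank zero in [Z x] are left out: each is represented by the top over [u x z]. *)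
Definition sub_dom : set Y := [set y | D (projT1 y) /\
  ((succ (projT1 y) /\ domain (Z (projT1 y)) (projT2 y) /\
     ord_zero < rank (projT2 y)) \/
   (~ succ (projT1 y) /\ projT2 y = t (projT1 y)))].

(* The projection [projT1] plays the role of a continuous map to [X]: [hat A] *)
(* is the preimage of [A], and [star W] is the open set determined by an open *)
(* set [W] of the system inserted below [x].                                  *)
Definition hat (A : set PX) : set Y := [set y | sub_dom y /\ A (projT1 y)].

Definition star x (W : set (point_of (Z x))) : set Y :=
  [set y | sub_dom y /\
    ((exists z, [/\ W z, ord_zero < rank z & y = mk z]) \/
     (exists z, [/\ W z, base x z & U x z (projT1 y)]))].

Definition sub_bas (y : Y) : set (set Y) :=
  [set B | (succ (projT1 y) /\ exists2 W, bas (projT2 y) W & B = star W) \/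
           (~ succ (projT1 y) /\ exists2 A, bas (projT1 y) A & B = hat A)].

(** Over a point of rank [osucc b] the ranks start just above [sg b] and end, at the top, with
    [sg (osucc b)]. *)
Definition sub_rank (y : Y) : ord :=
  if `[< succ (projT1 y) >]
  then oadd (sg (opred (rank (projT1 y)))) (rank (projT2 y))
  else sg (rank (projT1 y)).

Definition substitution : system := System sub_dom sub_bas sub_rank.

Lemma sg_le a b : a <= b -> sg a <= sg b.
Proof. by rewrite !le_eqVlt => /predU1P[->|/sg_lt ->]; rewrite ?eqxx ?orbT. Qed.

Lemma mk_inj x z z' : mk (x := x) z = mk z' -> z = z'.
Proof. exact: (@existT_inj2 {classic PX} (fun x => point_of (Z x))). Qed.

Lemma sub_rank_succ x z : succ x ->
  sub_rank (mk (x := x) z) = oadd (sg (opred (rank x))) (rank z).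
Proof. by rewrite /sub_rank /= => sx; case: asboolP. Qed.

Lemma sub_rank_nsucc x z : ~ succ x -> sub_rank (mk (x := x) z) = sg (rank x).
Proof. by rewrite /sub_rank /= => sx; case: asboolP. Qed.

Lemma sub_dom_top x : D x -> sub_dom (mk (t x)).
Proof.
move=> Dx; split=> //=; have [sx|nsx] := pselect (succ x); last by right.
by left; split=> //; split; [exact: t_dom|exact: t_gt0].
Qed.

Lemma sub_rank_top x : D x -> sub_rank (mk (t x)) = sg (rank x).
Proof.
move=> Dx; have [sx|nsx] := pselect (succ x).
  by rewrite sub_rank_succ // sg_succ.
exact: sub_rank_nsucc.
Qed.

Lemma top_eq x z : D x -> succ x -> domain (Z x) z -> z <> t x ->
  rank z < rank (t x).
Proof.
by move=> Dx sx Dz zt; apply: (ls_cone (ZP Dx sx) (t_dom Dx sx) (t_bas Dx sx)).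
Qed.

Lemma sub_rank_le y : sub_dom y -> sub_rank y <= sg (rank (projT1 y)).
Proof.
case: y => x z [/= Dx [[sx [Dz z0]]|[nsx _]]].
  rewrite -/(mk z) sub_rank_succ // sg_succ // oadd_le.
  have [->//|zt] := pselect (z = t x).
  exact/ltW/top_eq.
by rewrite -/(mk z) sub_rank_nsucc.
Qed.

Lemma sub_rank_gt y a : sub_dom y -> a < rank (projT1 y) -> sg a < sub_rank y.
Proof.
case: y => x z [/= Dx [[sx [Dz z0]]|[nsx _]]] a_lt.
  rewrite -/(mk z) sub_rank_succ //; apply: le_lt_trans (oadd_gt _ z0).
  by apply: sg_le; rewrite -lt_osuccE osucc_opred.
by rewrite -/(mk z) sub_rank_nsucc //; exact: sg_lt.
Qed.

Lemma hatS A B : A `<=` B -> hat A `<=` hat B.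
Proof. by move=> AB y [Dy Ay]; split=> //; exact: AB. Qed.

Lemma starS x (W W' : set (point_of (Z x))) : W `<=` W' -> star W `<=` star W'.
Proof.
move=> WW' y [Dy yW]; split=> //; case: yW => -[z [Wz zr Uz]].
  by left; exists z; split=> //; exact: WW'.
by right; exists z; split=> //; exact: WW'.
Qed.

Lemma bas_succ x z B : succ x -> sub_bas (mk (x := x) z) B ->
  exists2 W, bas z W & B = star W.
Proof. by move=> sx [[]|[]]. Qed.

Lemma bas_nsucc x z B : ~ succ x -> sub_bas (mk (x := x) z) B ->
  exists2 A, bas x A & B = hat A.
Proof. by move=> sx [[]|[]]. Qed.

Lemma star_bas x z W : succ x -> bas z W -> sub_bas (mk (x := x) z) (star W).
Proof. by move=> sx zW; left; split=> //; exists W. Qed.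

Lemma hat_bas x z A : ~ succ x -> bas x A -> sub_bas (mk (x := x) z) (hat A).
Proof. by move=> sx zW; right; split=> //; exists A. Qed.

(** Continuity of the projection. Over a point [x'] of successor rank only countably many [U x' z']
    leave [A]; their indices have rank zero, so [z] has a neighbourhood in [Z x'] avoiding them
    all. *)
Lemma hat_open x A y : D x -> bas x A -> hat A y ->
  exists2 B, sub_bas y B & B `<=` hat A.
Proof.
case: y => x' z Dx xA [[/= Dx' [[sx [Dz z0]]|[nsx ->]]] Ax'].
  have [A' x'A' A'A] := ls_open XP Dx xA Ax'.
  pose C := [set z' | base x' z' /\ ~ U x' z' `<=` A].
  have cC : countable C.
    apply: sub_countable (U_inside Dx' sx x'A'); apply: subset_card_le.
    by move=> z' [bz' nUA]; split=> // UA'; apply: nUA; exact: subset_trans A'A.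
  have [|W zW WC] := ls_avoid (ZP Dx' sx) Dz cC.
    by move=> [[_ zr] _]; rewrite zr ltxx in z0.
  exists (star W); first exact: star_bas.
  move=> y [Dy [[z' [Wz' _ yE]]|[z' [Wz' bz' Uz']]]]; split=> //.
    by rewrite yE.
  have [UA|nUA] := pselect (U x' z' `<=` A); first exact: UA.
  by case: (disjoint_elim WC Wz'); split.
have [A' x'A' A'A] := ls_open XP Dx xA Ax'.
exists (hat A'); [exact: hat_bas|exact: hatS].
Qed.

Lemma star_open x z W y : D x -> succ x -> domain (Z x) z -> bas z W ->
  star W y -> exists2 B, sub_bas y B & B `<=` star W.
Proof.
move=> Dx sx Dz zW [Dy [[z' [Wz' z'0 yE]]|[z' [Wz' bz' Uz']]]].
  have [W' z'W' W'W] := ls_open (ZP Dx sx) Dz zW Wz'.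
  by exists (star W'); [rewrite yE; exact: star_bas|exact: starS].
have [|B yB BU] := hat_open (u_dom Dx sx bz') (U_bas Dx sx bz') (y := y).
  by split.
exists B => //; apply: subset_trans BU _ => y' [Dy' Uy'].
by split=> //; right; exists z'.
Qed.

Section Lindelof.
Variable V : set (set Y).

Let covers (B : set Y) :=
  forall y, B y -> exists W A', [/\ V W, sub_bas y A' & A' `<=` W].

(* [C] only contains points of rank [0], at which the basic sets are the     *)
(* singletons, so that [W `\` C] is still open.                              *)
Lemma star_lindelof x z W C : D x -> succ x -> domain (Z x) z -> bas z W ->
  C `<=` base x -> covers (star (W `\` C)) ->
  (forall z', base x z' -> ~ C z' -> covers (hat (U x z')) ->
    countably_covered V (hat (U x z'))) ->
  countably_covered V (star (W `\` C)).
Proof.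
move=> Dx sx Dz zW Cb VW VU; have Zx := ZP Dx sx.
pose V' := [set W' | countably_covered V (star (W' `\` C))].
have [z' Wz'|F [FV' cF WF]] := ls_lindelof (V := V') Zx Dz zW; last first.
  apply: (@ccov_bigcup _ _ F (fun W' => star (W' `\` C))) => //.
  move=> y [Dy [[z' [[/WF[W' FW' W'z'] nCz'] z'0 yE]]|
                [z' [[/WF[W' FW' W'z'] nCz'] bz' Uz']]]];
    exists W' => //; split=> //; [left|right]; by exists z'.
have Dz' := ls_sub Zx Dz zW Wz'.
have [z'0|] := eqVneq (rank z') ord_zero; last first.
  rewrite -ord_zero_lt => z'0; have nCz' : ~ C z'.
    by move=> /Cb[_ zr]; rewrite zr ltxx in z'0.
  have [|W0 [B0 [VW0 /(bas_succ sx)[W1 z'W1 ->] B0W0]]] := VW (mk z').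
    by split; [split=> //=; left|left; exists z'].
  exists W1, W1; split=> //; apply: ccov1 VW0 _.
  by apply: subset_trans B0W0; apply: starS; exact: subDsetl.
have [W' z'W'] := ls_ex Zx Dz'; exists W', W'; split=> //; rewrite /V' /=.
rewrite (ls_bas0 Zx Dz' z'0 z'W'); have [Cz'|nCz'] := pselect (C z').
  by apply: ccov0; apply/seteqP; split=> // y [_ [[_ [[-> nC]]]|[_ [[-> nC]]]]].
apply: (@ccov_sub _ _ _ (hat (U x z'))).
  move=> y [Dy [[_ [[-> _]]]|[_ [[-> _] _ Uz']]]]; last by split.
  by rewrite z'0 ltxx.
apply: VU => // y [Dy Uy]; apply: VW; split=> //; right.
by exists z'.
Qed.

(** Induction on the rank of [x]; the other points of [A] have smaller rank. If [x] has no successor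
    rank, one member of [V] covers the part over a neighbourhood of [x]. Otherwise [U_tail] shrinks
    [A] to [x] and cones [U x z] inside [A]; the part above lies in a [star], and [star_lindelof]
    needs only the sets [hat (U x z)], based at points of smaller rank. *)
Lemma hat_lindelof x A : D x -> bas x A -> covers (hat A) ->
  countably_covered V (hat A).
Proof.
elim/(@rank_ind X): x A => x IH A Dx xA VA.
have VS A' : A' `<=` A -> covers (hat A').
  by move=> A'A y Ay; apply: VA; exact: hatS Ay.
pose V' := [set A' | countably_covered V (hat A')].
have [x' Ax'|F [FV' cF AF]] := ls_lindelof (V := V') XP Dx xA; last first.
  apply: (@ccov_bigcup _ _ F hat) => // y [Dy /AF[A' FA' A'y]].
  by exists A'.
have Dx' := ls_sub XP Dx xA Ax'.
have [x'x|xx'] := pselect (x' = x); last first.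
  have [A' x'A' A'A] := ls_open XP Dx xA Ax'.
  exists A', A'; split=> //; apply: (IH x') => //; last exact: VS.
  exact: (ls_cone XP Dx xA).
rewrite {x'}x'x in Ax' Dx' *.
have [sx|nsx] := pselect (succ x); last first.
  have [|W [B [VW /(bas_nsucc nsx)[A' xA' ->] A'W]]] := VA (mk (t x)).
    by split=> //; exact: sub_dom_top.
  by exists A', A'; split=> //; exact: ccov1 VW _.
pose C := [set z | base x z /\ ~ U x z `<=` A].
have [A' xA' A'U] := U_tail Dx sx (U_inside Dx sx xA).
exists A', A'; split=> //.
apply: (@ccov_sub _ _ _ (star (domain (Z x) `\` C))); last first.
  apply: (star_lindelof Dx sx (t_dom Dx sx) (t_bas Dx sx)) => [z []//||].
    move=> y [Dy [[z [_ _ yE]]|[z [[_ nCz] bz Uz]]]]; apply: VA; split=> //.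
      by rewrite yE.
    by have [UA|nUA] := pselect (U x z `<=` A); [exact: UA|case: nCz].
  move=> z bz _; apply: IH (u_dom Dx sx bz) (U_bas Dx sx bz).
  by rewrite -(u_rank Dx sx bz) lt_osucc.
move=> y [Dy /A'U[yx|[z [bz nCz] Uz]]]; split=> //; last first.
  by right; exists z; split=> //; split=> //; exact: bz.1.
case: y yx Dy => x' z /= x'x; rewrite {x'}x'x in z *.
move=> [/= _ [[_ [Dz z0]]|[]//]].
by left; exists z; split=> //; split=> // -[[_ zr] _]; rewrite zr ltxx in z0.
Qed.

End Lindelof.

Lemma substitution_system : LLSP_system substitution.
Proof.
have dom_succ x z : succ x -> sub_dom (mk (x := x) z) ->
    [/\ D x, domain (Z x) z & ord_zero < rank z].
  by move=> sx [/= Dx [[_ []]|[]]].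
have dom_nsucc x z : ~ succ x -> sub_dom (mk (x := x) z) -> D x /\ z = t x.
  by move=> sx [/= Dx [[]|[]]].
split.
- move=> [x z] B; rewrite -/(mk z) => Dy yB; have [sx|nsx] := pselect (succ x).
    have [Dx Dz z0] := dom_succ _ _ sx Dy; have [W zW ->] := bas_succ sx yB.
    split=> //; left; exists z; split=> //; exact: ls_mem (ZP Dx sx) _ _ Dz zW.
  have [Dx zt] := dom_nsucc _ _ nsx Dy; have [A xA ->] := bas_nsucc nsx yB.
  by split=> //=; exact: ls_mem XP _ _ Dx xA.
- by move=> [x z] B _ [[_ [W _ ->]]|[_ [A _ ->]]] y [].
- move=> [x z] B y; rewrite -/(mk z) => Dy yB; have [sx|nsx] := pselect (succ x).
    have [Dx Dz z0] := dom_succ _ _ sx Dy; have [W zW ->] := bas_succ sx yB.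
    exact: star_open Dx sx Dz zW.
  have [Dx zt] := dom_nsucc _ _ nsx Dy; have [A xA ->] := bas_nsucc nsx yB.
  exact: hat_open Dx xA.
- move=> [x z] F; rewrite -/(mk z) => Dy cF Fbas.
  have [sx|nsx] := pselect (succ x).
    have [Dx Dz z0] := dom_succ _ _ sx Dy.
    have [|h hP] := @choice_on _ _ set0 F (fun B W => bas z W /\ B = star W).
      by move=> B /Fbas/(bas_succ sx)[W]; exists W.
    have [B FB|W zW WF] := ls_cap_fam (ZP Dx sx) (f := h) Dz cF.
      by exists (h B) => //; exact: (hP B FB).1.
    exists (star W); first exact: star_bas.
    by move=> B FB; rewrite (hP B FB).2; apply: starS; exact: WF.
  have [Dx zt] := dom_nsucc _ _ nsx Dy.
  have [|h hP] := @choice_on _ _ set0 F (fun B A => bas x A /\ B = hat A).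
    by move=> B /Fbas/(bas_nsucc nsx)[W]; exists W.
  have [B FB|A xA AF] := ls_cap_fam XP (f := h) Dx cF.
    by exists (h B) => //; exact: (hP B FB).1.
  exists (hat A); first exact: hat_bas.
  by move=> B FB; rewrite (hP B FB).2; apply: hatS; exact: AF.
- move=> [x z] [x' z'] Dy Dy' yy'; have [xx'|xx'] := pselect (x = x'); last first.
    have [A [A' [xA x'A' AA']]] := ls_sep XP Dy.1 Dy'.1 xx'.
    have [|B yB BA] := hat_open (y := mk z) Dy.1 xA.
      by split=> //; exact: ls_mem XP _ _ Dy.1 xA.
    have [|B' yB' BA'] := hat_open (y := mk z') Dy'.1 x'A'.
      by split=> //; exact: ls_mem XP _ _ Dy'.1 x'A'.
    exists B, B'; split=> //; apply/seteqP; split=> // y [/BA[_ Ay] /BA'[_ A'y]].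
    exact: disjoint_elim AA' Ay A'y.
  rewrite -{}xx' in z' Dy' yy' *; rewrite -!/(mk _) in Dy Dy' yy' *.
  have [sx|nsx] := pselect (succ x); last first.
    have [_ zt] := dom_nsucc _ _ nsx Dy; have [_ z't] := dom_nsucc _ _ nsx Dy'.
    by case: yy'; rewrite zt z't.
  have [Dx Dz z0] := dom_succ _ _ sx Dy; have [_ Dz' z'0] := dom_succ _ _ sx Dy'.
  have [|W [W' [zW z'W' WW']]] := ls_sep (ZP Dx sx) Dz Dz'.
    by move=> zz'; rewrite zz' in yy'.
  exists (star W), (star W'); split; try exact: star_bas.
  (* [U x v] is a cone on a point below [x], so the points inserted over [x] are not in the part of
     a [star] lying over the cones. *)
  have UN v : base x v -> ~ U x v x.
    move=> bv Uvx; have xu : x <> u x v.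
      by move=> xu; have := lt_osucc (rank (u x v)); rewrite u_rank // -xu ltxx.
    have := ls_cone XP (u_dom Dx sx bv) (U_bas Dx sx bv) Uvx xu.
    by rewrite -(u_rank Dx sx bv) ltNge ltW // lt_osucc.
  apply/seteqP; split=> // y [[_ [[v [Wv _ yE]]|[v [Wv bv Uv]]]]
                             [_ [[w [Ww _ yE']]|[w [Ww bw Uw]]]]].
  + by apply: (disjoint_elim WW' Wv); rewrite (@mk_inj x v w) // -yE.
  + by apply: (UN w bw); rewrite yE in Uw.
  + by apply: (UN v bv); rewrite yE' in Uv.
  + have [vw|vw] := pselect (v = w); first by apply: (disjoint_elim WW' Wv); rewrite vw.
    exact: disjoint_elim (U_disj Dx sx bv bw vw) Uv Uw.
- move=> [x z] B V; rewrite -/(mk z) => Dy yB; have [sx|nsx] := pselect (succ x).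
    have [Dx Dz z0] := dom_succ _ _ sx Dy; have [W zW ->] := bas_succ sx yB.
    rewrite -[W]setD0 => VW; apply: (star_lindelof Dx sx Dz zW) => //.
    by move=> z' bz' _; exact: hat_lindelof (u_dom Dx sx bz') (U_bas Dx sx bz').
  have [Dx zt] := dom_nsucc _ _ nsx Dy; have [A xA ->] := bas_nsucc nsx yB.
  exact: hat_lindelof Dx xA.
- move=> [x z] B y'; rewrite -/(mk z) => Dy yB; have [sx|nsx] := pselect (succ x).
    have [Dx Dz z0] := dom_succ _ _ sx Dy; have [W zW ->] := bas_succ sx yB.
    move=> [Dy' [[z' [Wz' z'0 ->]]|[z' [Wz' bz' Uz']]]] yy'; rewrite /= sub_rank_succ //.
      rewrite sub_rank_succ //; apply: oadd_lt; apply: (ls_cone (ZP Dx sx) Dz zW) => //.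
      by move=> zz'; rewrite zz' in yy'.
    apply: le_lt_trans (sub_rank_le Dy') _; apply: le_lt_trans _ (oadd_gt _ z0).
    apply: sg_le; rewrite (_ : opred (rank x) = rank (u x z')); last first.
      by rewrite -(u_rank Dx sx bz') osuccK.
    have [->//|yu] := pselect (projT1 y' = u x z').
    by apply: ltW; apply: (ls_cone XP (u_dom Dx sx bz') (U_bas Dx sx bz')).
  have [Dx zt] := dom_nsucc _ _ nsx Dy; have [A xA ->] := bas_nsucc nsx yB.
  case: y' => x' z'; rewrite -/(mk z') => -[Dy' Ax'] yy'.
  rewrite /= (sub_rank_nsucc z nsx); apply: le_lt_trans (sub_rank_le Dy') _.
  apply: sg_lt; apply: (ls_cone XP Dx xA) => //= xx'.
  rewrite {}xx' in z' Dy' yy' Ax'; have [_ z't] := dom_nsucc _ _ nsx Dy'.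
  by case: yy'; rewrite zt z't.
- move=> [x z] B c; rewrite -/(mk z) => Dy yB; have [sx|nsx] := pselect (succ x).
    have [Dx Dz z0] := dom_succ _ _ sx Dy; have [W zW ->] := bas_succ sx yB.
    rewrite /= sub_rank_succ // => c_lt.
    have [d d_lt cd] : exists2 d, d < rank z & c <= oadd (sg (opred (rank x))) d.
      have [c_lt'|//] := lt_oadd c_lt; exists ord_zero; rewrite ?oadd0 //.
      exact: ltW.
    have [z' [Wz' zz' dz']] := ls_cofinal (ZP Dx sx) Dz zW d_lt.
    have Dz' := ls_sub (ZP Dx sx) Dz zW Wz'.
    (* If [z'] has rank zero, the top over [u x z'] replaces it; its rank is
       [sg (opred (rank x))]. *)
    have [z'0|] := eqVneq (rank z') ord_zero; last first.
      rewrite -ord_zero_lt => z'0; exists (mk z'); split.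
      - split; first by split=> //=; left.
        by left; exists z'.
      - by move/mk_inj.
      - by rewrite sub_rank_succ //; apply: le_trans cd _; rewrite oadd_le.
    have bz' : base x z' by [].
    have Du := u_dom Dx sx bz'; exists (mk (t (u x z'))); split.
    - split; first exact: sub_dom_top.
      right; exists z'; split=> //=; exact: ls_mem XP _ _ Du (U_bas Dx sx bz').
    - move=> /(congr1 (@projT1 _ _)) /= ux; have := lt_osucc (rank (u x z')).
      by rewrite u_rank // ux ltxx.
    - rewrite sub_rank_top // (_ : rank (u x z') = opred (rank x)).
        apply: le_trans cd _; rewrite -[leRHS]oadd0 oadd_le.
        by rewrite -z'0.
      by rewrite -(u_rank Dx sx bz') osuccK.
  have [Dx zt] := dom_nsucc _ _ nsx Dy; have [A xA ->] := bas_nsucc nsx yB.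
  rewrite /= sub_rank_nsucc // => /(sg_lim nsx)[b b_lt cb].
  have [x' [Ax' xx' bx']] := ls_cofinal XP Dx xA b_lt.
  have Dx' := ls_sub XP Dx xA Ax'; exists (mk (t x')); split.
  - by split=> //; exact: sub_dom_top.
  - by move=> /(congr1 (@projT1 _ _)).
  - by rewrite sub_rank_top //; apply: le_trans cb _; exact: sg_le.
Qed.

(** A [star] projects into [x] together with the cones [U x z']; a single neighbourhood [A] of [x]
    absorbs all but countably many of these, and each remaining cone is itself basic. *)
Lemma projection_covered B : basic substitution B ->
  countably_covered (basic X) [set projT1 y | y in B].
Proof.
case=> -[x z] [/= Dx _] [[/= sx [W zW ->]]|[nsx [A xA ->]]]; last first.
  have bA : basic X A by exists x.
  by apply: ccov1 bA _ => _ [y [_ Ay] <-].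
have [A xA] := ls_ex XP Dx; have bA : basic X A by exists x.
pose C := [set z' | base x z' /\ ~ U x z' `<=` A].
apply: (@ccov_sub _ _ _ (A `|` \bigcup_(z' in C) U x z')); last first.
  apply: ccovU; first exact: ccov1 bA _.
  apply: (ccov_bigcup (U_inside Dx sx xA)) => [z' [bz' _]|y Cy]; last exact: Cy.
  apply: (@ccov1 _ _ _ (U x z')) => //.
  by exists (u x z'); [exact: u_dom|exact: U_bas].
move=> _ [y [_ [[z' [_ _ ->]]|[z' [_ bz' Uz']]]] <-].
  by left; exact: ls_mem XP _ _ Dx xA.
have [UA|nUA] := pselect (U x z' `<=` A); first by left; exact: UA.
by right; exists z'.
Qed.

(** * Height, goodness and width of the substitution *)

Variables th al : ord.
Hypothesis XG : good_system th X.
Hypothesis sg0 : sg ord_zero = ord_zero.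
Hypothesis sg_al : forall a, a < th -> sg a < al.
Hypothesis al_sg : forall e, e < al -> exists2 a, a < th & e <= sg a.
Hypothesis Z_uncountable : forall x d, D x -> succ x -> d < rank (t x) ->
  ~ countable (level (Z x) d).
Hypothesis Z_width : forall x d, D x -> succ x ->
  level (Z x) d #<= below omega1.

(** By [sub_rank_le] and [sub_rank_gt], points of different rank in [X] have above them disjoint
    intervals of new ranks. *)
Lemma sub_level_proj y y' : sub_dom y -> sub_dom y' ->
  sub_rank y = sub_rank y' -> rank (projT1 y) = rank (projT1 y').
Proof.
have lt w w' : sub_dom w -> sub_dom w' ->
    rank (projT1 w) < rank (projT1 w') -> sub_rank w < sub_rank w'.
  move=> Dw Dw' /(sub_rank_gt Dw'); apply: le_lt_trans.
  exact: sub_rank_le.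
move=> Dy Dy' yy'; apply/eqP; case: ltgtP => // /lt; rewrite yy' ltxx;
  by move=> ->.
Qed.

(** For goodness it suffices to find uncountably many points whose projection avoids the countable
    cover [F'] in [X]. Let [a] be least with [e <= sg a]. If [sg a = e], the tops over the uncovered
    points of rank [a] serve. Otherwise [a] is a successor by continuity of [sg], and a single
    uncovered [x] is enough: a whole level of [Z x] lies over it. *)
Lemma substitution_good : good_system al substitution.
Proof.
split.
- exact: substitution_system.
- move=> y Dy; apply: le_lt_trans (sub_rank_le Dy) _; apply: sg_al.
  exact: gs_lt XG _ Dy.1.
- move=> e F e_al cF FS.
  have [F' [F'X cF' FF']] : countably_covered (basic X)
      (\bigcup_(B in F) ([set projT1 y | y in (B : set Y)])).
    apply: (ccov_bigcup cF) => [B /FS|y Fy]; last exact: Fy.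
    exact: projection_covered.
  have [|/= ] := @leastP [set a | e <= sg a].
    by have [a _ ea] := al_sg e_al; exists a.
  set a := least _ => ea amin.
  have a_th : a < th.
    by have [b b_th eb] := al_sg e_al; apply: le_lt_trans b_th; exact: amin.
  have miss y B : F B -> B y -> ~ (\bigcup_(A in F') A) (projT1 y) -> False.
    by move=> FB By; apply; apply: FF'; exists B => //; exists y.
  have unc := gs_good XG a_th cF' F'X.
  have [sge|] := eqVneq (sg a) e.
    move=> cY; apply: unc; apply: sub_countable cY.
    apply: (@card_le_inj _ _ (fun x => mk (t x))) => [x [[Dx xa] nx]|x x' _ _].
      split; last by move=> [B FB By]; exact: (miss _ _ FB By).
      split; first exact: sub_dom_top.
      by rewrite /= sub_rank_top // xa.
    by move/(congr1 (@projT1 _ _)).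
  move=> sge; have {}sge : e < sg a by rewrite lt_neqAle eq_sym sge ea.
  have sa : is_succ a.
    apply: contrapT => nsa; have [b ba eb] := sg_lim nsa sge.
    by have := amin b eb; rewrite leNgt ba.
  have [S0|/set0P[x [[Dx xa] nx]]] :=
    eqVneq (level X a `\` \bigcup_(A in F') A) set0.
    by case: unc; rewrite S0.
  have sx : succ x by rewrite /succ xa.
  have sgb : sg (opred (rank x)) < e.
    rewrite ltNge; apply/negP => /amin; rewrite leNgt -xa.
    by rewrite -[X in _ < X](osucc_opred sx) lt_osucc.
  have [|d d_lt eE] := oadd_between (ltW sgb) (c := rank (t x)) _.
    by rewrite -sg_succ // xa.
  have d0 : ord_zero < d.
    rewrite ord_zero_lt; apply/eqP => d0.
    by move: sgb; rewrite eE d0 oadd0 ltxx.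
  move=> cY; apply: (Z_uncountable Dx sx d_lt); apply: sub_countable cY.
  apply: (@card_le_inj _ _ (fun z => mk (x := x) z)) => [z [Dz zd]|z z' _ _].
    split; last by move=> [B FB By]; exact: (miss _ _ FB By).
    split; first by split=> //=; left; rewrite zd.
    by rewrite /= sub_rank_succ // zd eE.
  exact: mk_inj.
- move=> e; have [->|/set0P[y [Dy ye]]] := eqVneq (level substitution e) set0.
    exact: card_ge0.
  set a := rank (projT1 y); set d := rank (projT2 y).
  (* By [sub_level_proj], level [e] lies over the single level [a] of [X], and it meets the part
     over each [x] in [fib x]. *)
  pose fib x : set (point_of (Z x)) :=
    if `[< is_succ a >] then level (Z x) d else [set t x].
  apply: (@card_le_trans _ _ _
    (\bigcup_(x in level X a) ((fun z => mk (x := x) z) @` fib x))).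
    apply: subset_card_le => y' [Dy' y'e].
    have aE : rank (projT1 y') = a by apply: sub_level_proj => //; exact: etrans y'e (esym ye).
    exists (projT1 y'); first by split=> //; exact: Dy'.1.
    exists (projT2 y'); last by case: y' {Dy' y'e aE}.
    rewrite /fib; case: asboolP => sa; last first.
      by case: Dy' => _ [[]|[]//]; rewrite /succ aE.
    case: (Dy') => _ [[_ [Dz _]]|[]]; last by rewrite /succ aE.
    split=> //; apply: (@oadd_inj (sg (opred a))).
    have sy' : succ (projT1 y') by rewrite /succ aE.
    move: y'e; rewrite -ye /= /sub_rank aE -/a.
    by do 2!case: asboolP => //.
  apply: card_bigcup_omega1 (gs_width XG a) _ => x [Dx xa].
  apply: (card_le_trans (card_image_le _ _)).
  rewrite /fib; case: asboolP => sa; first by apply: Z_width; rewrite // /succ xa.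
  apply: (@card_le_inj _ _ (fun=> ord_zero)) => [_ _|_ _ -> ->] //.
  exact: ord_zero_lt_omega1.
- apply: card_le_trans (gs_level0 XG) _.
  apply: (@card_le_inj _ _ (fun x => mk (t x))) => [x [Dx xa]|x x' _ _].
    by split; [exact: sub_dom_top|rewrite /= sub_rank_top // xa].
  by move/(congr1 (@projT1 _ _)).
Qed.

End Substitution.

(** * From systems to spaces *)

(** In the set where [r] is at least [a], cones isolate the points with [r y = a], while cofinality
    keeps those with larger [r] from being isolated. *)
Lemma cb_derivative_rank (Y : topologicalType) (r : Y -> ord) :
  (forall y : Y, exists2 V, nbhs y V & forall w, V w -> w <> y -> r w < r y) ->
  (forall (y : Y) V c, nbhs y V -> c < r y -> exists w, [/\ V w, w <> y & c <= r w]) ->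
  forall a, cb_derivative Y a = [set y | a <= r y].
Proof.
move=> cone cof a; elim/(well_founded_ind ord_lt_wf): a => a IH.
rewrite cb_derivativeE; apply/seteqP; split=> y /=.
  move=> ya; rewrite leNgt; apply/negP => /[dup] ry_lt /ya [_]; apply.
  rewrite IH //; split; first exact: mem_set (lexx _).
  have [V yV Vr] := cone y; exists V => //; apply/seteqP; split=> [w [Vw /= yw]|_ ->].
    by apply: contrapT => /(Vr _ Vw); rewrite ltNge yw.
  by split; [exact: nbhs_singleton|exact: lexx].
move=> ay b ba; rewrite IH //; split; first exact: ltW (lt_le_trans ba ay).
move=> [_ [V yV VE]]; have [w [Vw wy bw]] := cof y V b yV (lt_le_trans ba ay).
by apply: wy; have : (V `&` [set y | b <= r y]) w by []; rewrite VE.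
Qed.

Section RankedSpace.
Variables (Y : topologicalType) (r : Y -> ord).
Hypothesis cbE : forall a, cb_derivative Y a = [set y | a <= r y].

Lemma cb_level_rank a : cb_level Y a = [set y | r y = a].
Proof.
rewrite /cb_level !cbE; apply/seteqP; split=> y /=.
  by move=> [ay /negP]; rewrite osucc_le -leNgt => ya; apply/le_anti; rewrite ya.
by move=> <-; split=> //; rewrite osucc_le ltxx.
Qed.

End RankedSpace.

Section SystemSpace.
Variables (S : system) (SP : LLSP_system S).

(** Indexing the type by the proof lets the topology, whose axioms come from that proof, be declared
    as an instance. *)
Definition system_space (_ : LLSP_system S) : Type :=
  {x : point_of S | domain S x}.
Local Notation Y := (system_space SP).

HB.instance Definition _ := gen_eqMixin Y.
HB.instance Definition _ := gen_choiceMixin Y.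

Let pt (y : Y) : point_of S := sval y.

Definition system_open (V : set Y) := forall y, V y ->
  exists2 A, bas (pt y) A & pt @^-1` A `<=` V.

Let system_openT : system_open setT.
Proof. by move=> y _; have [A yA] := ls_ex SP (svalP y); exists A. Qed.

Let system_openI : setI_closed system_open.
Proof.
move=> V W oV oW y [Vy Wy].
have [[] _|A yA AVW] := @ls_cap_fam _ SP (pt y) bool setT
  (* A set of the space is carried to [point_of S] by a universal condition, which holds vacuously
     outside the domain. *)
  (fun b => [set x | forall w, pt w = x -> (if b then V else W) w])
  (svalP y) (countableP _).
- have [A yA AV] := oV y Vy; exists A => // x Ax w wx.
  by apply: AV; rewrite /preimage /= wx.
- have [A yA AV] := oW y Wy; exists A => // x Ax w wx.
  by apply: AV; rewrite /preimage /= wx.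
exists A => // w Aw; split; first exact: (AVW true I _ Aw).
exact: (AVW false I _ Aw).
Qed.

Let system_open_bigU (I : Type) (f : I -> set Y) :
  (forall i, system_open (f i)) -> system_open (\bigcup_i f i).
Proof.
move=> of_ y [i _ fy]; have [A yA Af] := of_ i y fy; exists A => // w /Af fw.
by exists i.
Qed.

HB.instance Definition _ := @isOpenTopological.Build Y system_open
  system_openT system_openI system_open_bigU.

End SystemSpace.

Section SystemSpaceTheory.
Variables (al : ord) (S : system) (SG : good_system al S) (al_gt0 : ord_zero < al).
Let SP := gs_sys SG.
Local Notation Y := (system_space SP).
Let pt (y : Y) : point_of S := sval y.

Let pt_inj (y w : Y) : pt y = pt w -> y = w.
Proof.
case: y w => [y Dy] [w Dw] /= yw; rewrite {}yw in Dy *.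
by congr exist; exact: Prop_irrelevance.
Qed.

Let openE (V : set Y) : open V = system_open V.
Proof. by []. Qed.

Let bas_open x A : domain S x -> bas x A -> open (pt @^-1` A).
Proof.
move=> Dx xA; rewrite openE => y Ay; have [A' yA' A'A] := ls_open SP Dx xA Ay.
by exists A' => // w; exact: A'A.
Qed.

Let nbhsP (y : Y) (V : set Y) :
  nbhs y V <-> exists2 A, bas (pt y) A & pt @^-1` A `<=` V.
Proof.
rewrite nbhsE; split=> [[W [oW Wy] WV]|[A yA AV]].
  by have [A yA AW] := oW y Wy; exists A => // w /AW; exact: WV.
exists (pt @^-1` A) => //; split; first exact: bas_open (svalP y) yA.
exact: ls_mem SP _ _ (svalP y) yA.
Qed.

Let cbE a : cb_derivative Y a = [set y | a <= rank (pt y)].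
Proof.
apply: cb_derivative_rank => [y|y V c /nbhsP[A yA AV] c_lt].
  have [A yA] := ls_ex SP (svalP y); exists (pt @^-1` A).
    by apply/nbhsP; exists A.
  move=> w Aw wy; apply: (ls_cone SP (svalP y) yA Aw) => wyE.
  by apply: wy; exact: pt_inj.
have [x [Ax xy cx]] := ls_cofinal SP (svalP y) yA c_lt.
have Dx := ls_sub SP (svalP y) yA Ax.
exists (exist _ x Dx); split=> //; first exact: AV.
by move=> yE; apply: xy; rewrite -yE.
Qed.

Let level_uncountable e F : e < al -> countable F -> F `<=` basic S ->
  ~ countable (cb_level Y e `\` \bigcup_(A in F) (pt @^-1` A)).
Proof.
move=> e_al cF FS cY; apply: (gs_good SG e_al cF FS).
apply: (@sub_countable _ _ _ (pt @` (cb_level Y e `\` \bigcup_(A in F) (pt @^-1` A)))).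
  apply: subset_card_le => x [[Dx xe] nFx]; exists (exist _ x Dx) => //.
  by split; [rewrite (cb_level_rank cbE)|move=> [A FA Ax]; apply: nFx; exists A].
exact: sub_countable (card_image_le _ _) cY.
Qed.

Let heightY : height Y = al.
Proof.
apply/le_anti/andP; split.
  apply: least_le; rewrite /= cbE; apply/seteqP; split=> // y /=.
  by rewrite leNgt (gs_lt SG (svalP y)).
rewrite leNgt; apply/negP => h_lt.
have : cb_derivative Y (height Y) = set0.
  have [|//] := @leastP [set a | cb_derivative Y a = set0].
  exists al => /=; rewrite cbE; apply/seteqP; split=> // y /=.
  by rewrite leNgt (gs_lt SG (svalP y)).
move=> cb0; have := @level_uncountable (height Y) set0 h_lt (countable0 _) (@sub0set _ _).
by apply; rewrite /cb_level cb0 !set0D.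
Qed.

Let widthY : width Y = omega1.
Proof.
have omP : [set k | is_cardinal k /\
    forall a, a < height Y -> cb_level Y a #<= below k] omega1.
  split; first exact: omega1_cardinal.
  move=> a _; apply: card_le_trans (gs_width SG a).
  rewrite (cb_level_rank cbE); apply: (@card_le_inj _ _ pt) => [y <-|y w _ _].
    by split=> //; exact: svalP.
  exact: pt_inj.
apply/le_anti/andP; split; first exact: least_le.
have [[_ kP] _] := @leastP _ (ex_intro _ _ omP).
rewrite leNgt; apply/negP => /countable_below ck.
have := @level_uncountable ord_zero set0 al_gt0 (countable0 _) (@sub0set _ _).
apply; rewrite bigcup_set0 setD0; apply: sub_countable ck.
by apply: kP; rewrite heightY.
Qed.

Let bas_lindelof x A : domain S x -> bas x A -> lindelof (pt @^-1` A).
Proof.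
move=> Dx xA C Co AC.
pose V : set (set (point_of S)) := [set [set x | forall w, pt w = x -> W w] | W in C].
have [y Ay|F [FV cF AF]] := ls_lindelof (V := V) SP Dx xA.
  have Dy := ls_sub SP Dx xA Ay; have [W CW Wy] := AC (exist _ y Dy) Ay.
  have [A' yA' A'W] := Co W CW _ Wy; exists [set x | forall w, pt w = x -> W w], A'.
  split=> //; first by exists W.
  by move=> z A'z w wz; apply: A'W; suff : A' (pt w) by []; rewrite wz.
have [|h hP] := @choice_on _ _ set0 F (fun B W => C W /\
    [set x | forall w, pt w = x -> W w] = B).
  by move=> B /FV[W CW WB]; exists W.
exists (h @` F); split=> [_ [B /hP[CB _] <-] //||y /AF[B FB By]].
  exact: sub_countable (card_image_le _ _) cF.
exists (h B); first by exists B.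
by have [_ hB] := hP B FB; rewrite -[X in X (pt y)]hB in By; exact: By.
Qed.

Lemma system_space_LLSP : LLSP_of omega1 al Y /\ good Y.
Proof.
split; first split=> //.
  split.
  - move=> y; have [A yA] := ls_ex SP (svalP y); exists (pt @^-1` A).
      by apply/nbhsP; exists A.
    exact: bas_lindelof (svalP y) yA.
  - exists al; rewrite cbE; apply/seteqP; split=> // y /=.
    by rewrite leNgt (gs_lt SG (svalP y)).
  - move=> y w yw; apply: contrapT => yNw.
    have [|A [A' [yA wA' AA']]] := ls_sep SP (svalP y) (svalP w).
      by move/pt_inj.
    have [||v [Av A'v]] := yw (pt @^-1` A) (pt @^-1` A').
    + by apply/nbhsP; exists A.
    + by apply/nbhsP; exists A'.
    + exact: disjoint_elim AA' Av A'v.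
  - move=> V oV; rewrite openE => y Vy.
    have [n _|A yA AV] := @ls_cap_fam _ SP (pt y) nat setT
      (fun n => [set x | forall w, pt w = x -> V n w]) (svalP y) (countableP _).
      have [A yA AV] := oV n y (Vy n I); exists A => // x Ax w wx.
      by apply: AV; suff : A (pt w) by []; rewrite wx.
    by exists A => // w Aw n _; exact: (AV n I _ Aw).
move=> a U; rewrite heightY => a_al Ucone.
(* The given cones need not be basic sets of [S], but being Lindelof each is covered by countably
   many of them. *)
have Ucov n : countably_covered [set pt @^-1` A | A in basic S] (U n).
  have [x [lU _ _]] := Ucone n; apply: lU => [_ [A [z Dz zA] <-]|y Uy].
    exact: bas_open zA.
  have [A yA] := ls_ex SP (svalP y); exists (pt @^-1` A).
    by exists A => //; exists (pt y) => //; exact: svalP.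
  exact: ls_mem SP _ _ (svalP y) yA.
have [F [FS cF UF]] : countably_covered [set pt @^-1` A | A in basic S] (\bigcup_n U n).
  exact: (@ccov_bigcup _ _ setT U).
have [|h hP] := @choice_on _ _ set0 F (fun B A => basic S A /\ pt @^-1` A = B).
  by move=> B /FS[A SA AB]; exists A.
move=> cY; apply: (@level_uncountable a (h @` F) a_al).
- exact: sub_countable (card_image_le _ _) cF.
- by move=> _ [B /hP[SB _] <-].
- apply: sub_countable cY; apply: subset_card_le => y [ya ny]; split=> //.
  move=> /UF[B FB By]; apply: ny; exists (h B); first by exists B.
  by rewrite (hP B FB).2.
Qed.

End SystemSpaceTheory.

(** * From spaces to systems *)

Section SpaceSystem.
Variables (X : topologicalType) (XL : LLSP X).

Let X_loc : locally_lindelof X. Proof. by case: XL. Qed.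
Let X_scat : scattered X. Proof. by case: XL. Qed.
Let X_haus : hausdorff_space X. Proof. by case: XL. Qed.
Let X_P : P_space X. Proof. by case: XL. Qed.

Lemma level_ofP (x : X) : cb_level X (level_of x) x.
Proof.
apply: (@xgetPex _ ord_zero [set a | cb_level X a x]).
have [|/= nx xmin] := @leastP [set a | ~ cb_derivative X a x].
  by have [a a0] := X_scat; exists a; rewrite /= a0.
set a := least _ in nx xmin; move: nx; rewrite cb_derivativeE.
move=> /existsNP[b /not_implyP[/= ba nb]]; exists b.
have xb : cb_derivative X b x.
  by apply: contrapT => /xmin; rewrite leNgt ba.
by split=> //; rewrite cb_derivativeS.
Qed.

Lemma cb_derivative_level a : cb_derivative X a = [set x | a <= level_of x].
Proof.
apply/seteqP; split=> x /= => [xa|ax].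
  rewrite leNgt; apply/negP; rewrite -osucc_le => la.
  by case: (level_ofP x) => _; apply; exact: cb_derivative_le la _ xa.
exact: cb_derivative_le ax _ (level_ofP x).1.
Qed.

Lemma cb_level_level a : cb_level X a = [set x | level_of x = a].
Proof. exact: cb_level_rank cb_derivative_level a. Qed.

(** * Separation and clopen cones in locally Lindelof P-spaces *)

Lemma P_space_bigcap (I : Type) (J : set I) (f : I -> set X) : countable J ->
  (forall i, J i -> open (f i)) -> open (\bigcap_(i in J) f i).
Proof.
move=> /countable_injP[h h_inj] fo.
rewrite (_ : \bigcap_(i in J) f i =
    \bigcap_n [set x | forall i, J i -> h i = n -> f i x]); last first.
  by apply/seteqP; split=> x fx i Ji; [move=> ? ? _; exact: fx|exact: (fx (h i))].
apply: X_P => n; have [[i Ji <-]|nin] := pselect (exists2 i, J i & h i = n).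
  rewrite (_ : mkset _ = f i); first exact: fo.
  apply/seteqP; split=> x fx; first exact: fx.
  by move=> j Jj hj; rewrite (h_inj j i) ?inE.
rewrite (_ : mkset _ = setT); first exact: openT.
by apply/seteqP; split=> // x _ i Ji hi; case: nin; exists i.
Qed.

Lemma lindelof_separated (K : set X) x : lindelof K -> ~ K x ->
  exists G H, [/\ open G, open H, G x, K `<=` H & G `&` H = set0].
Proof.
move=> lK nKx.
pose C := [set H : set X | open H /\ exists G, [/\ open G, G x & G `&` H = set0]].
have [|y Ky|C' [C'C cC' KC']] := lK C; first by move=> H [].
  have [AB [xA yB] [oA oB /eqP AB0]] : exists2 AB : set X * set X,
      x \in AB.1 /\ y \in AB.2 &
      [/\ open AB.1, open AB.2 & AB.1 `&` AB.2 == set0].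
    have := X_haus; rewrite open_hausdorff => /(_ x y); apply.
    by apply/eqP => xy; rewrite xy in nKx.
  exists AB.2; last exact: set_mem.
  by split=> //; exists AB.1; split=> //; exact: set_mem.
have [|G GP] := @choice_on _ _ set0 C'
    (fun H G => [/\ open G, G x & G `&` H = set0]); first by move=> H /C'C[].
exists (\bigcap_(H in C') G H), (\bigcup_(H in C') H); split=> //.
- by apply: P_space_bigcap => // H /GP[].
- by apply: bigcup_open => H /C'C[].
- by move=> H /GP[].
- apply/seteqP; split=> // y [Gy [H C'H Hy]].
  by have [_ _ GH] := GP H C'H; exact: disjoint_elim GH (Gy H C'H) Hy.
Qed.

Lemma closed_of_lindelof (K : set X) : lindelof K -> closed K.
Proof.
move=> lK; rewrite -[K]setCK; apply: open_closedC.
rewrite openE => x /(lindelof_separated lK)[G [H [oG oH Gx KH GH]]].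
rewrite /interior nbhsE; exists G; first by [].
by move=> y Gy Ky; exact: disjoint_elim GH Gy (KH y Ky).
Qed.

Lemma lindelof_closed_subset (K C : set X) : lindelof K -> closed C -> C `<=` K ->
  lindelof C.
Proof.
move=> lK cC CK V oV CV.
have [|y Ky|F [FV cF KF]] := lK (V `|` [set ~` C]).
- by move=> W [/oV//|->]; exact: closed_openC.
- have [/CV[W VW Wy]|nCy] := pselect (C y); first by exists W => //; left.
  by exists (~` C) => //; right.
exists (F `&` V); split; first by move=> W [].
- by apply: sub_countable cF; apply: subset_card_le; exact: subIsetl.
- move=> y Cy; have [W FW Wy] := KF y (CK y Cy); exists W => //; split=> //.
  by have [//|WC] := FV W FW; rewrite WC in Wy.
Qed.

Lemma P_space_regular (x : X) (O : set X) : nbhs x O ->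
  exists V, [/\ nbhs x V, closed V, lindelof V & V `<=` O].
Proof.
move=> xO; have [L xL lL] := X_loc x; have cL := closed_of_lindelof lL.
have cK : closed (L `\` interior O).
  by apply: closedI => //; apply: open_closedC; exact: open_interior.
have lK : lindelof (L `\` interior O).
  exact: lindelof_closed_subset lL cK (@subDsetl _ _ _).
have [|G [H [oG oH Gx KH GH]]] := lindelof_separated lK (x := x).
  by move=> [_]; apply; exact: xO.
have cV : closed (L `\` H) by apply: closedI => //; exact: open_closedC.
exists (L `\` H); split=> //.
- apply: filterS (filterI xL (open_nbhs_nbhs (conj oG Gx))) => y [Ly Gy].
  by split=> // Hy; exact: disjoint_elim GH Gy Hy.
- exact: lindelof_closed_subset lL cV (@subDsetl _ _ _).
- move=> y [Ly nHy]; apply: interior_subset; apply: contrapT => nOy.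
  by apply: nHy; exact: KH.
Qed.

(** Regularity gives closed neighbourhoods with [V n.+1] inside the interior of [V n]. Their
    intersection is closed, and it equals the intersection of the interiors, hence is open in a
    P-space. Starting inside a [W] that isolates [x] in its derivative makes it a cone. *)
Lemma cone_basis (x : X) (O : set X) : nbhs x O ->
  exists2 K, lindelof_clopen_cone x K & K `<=` O.
Proof.
move=> xO.
have [W xW WE] : exists2 W, nbhs x W &
    W `&` cb_derivative X (level_of x) = [set x].
  have [xl] := level_ofP x; rewrite cb_derivativeS => nx; apply: contrapT => nW.
  by apply: nx; split=> // -[_ [W xW WE]]; apply: nW; exists W.
have [V0 [xV0 cV0 lV0 V0O]] := P_space_regular (filterI xO xW).
have [|h hP] := @choice_on _ _ set0 (nbhs x)
    (fun V V' => [/\ nbhs x V', closed V' & V' `<=` interior V]).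
  by move=> V /nbhs_interior/P_space_regular[V' [? ? _ ?]]; exists V'.
pose V n := iter n h V0.
have xV n : nbhs x (V n) by elim: n => // n IH; have [] := hP _ IH.
have cV n : closed (V n) by case: n => // n; have [] := hP _ (xV n).
have VS n : V n.+1 `<=` interior (V n) by have [] := hP _ (xV n).
have KE : \bigcap_n V n = \bigcap_n interior (V n).
  apply/seteqP; split=> y Vy n _; last exact: interior_subset (Vy n I).
  exact: VS (Vy n.+1 I).
have KV0 : \bigcap_n V n `<=` V0 by move=> y /(_ 0%N I).
have cK : closed (\bigcap_n V n) by apply: closed_bigI.
have oK : open (\bigcap_n V n).
  by rewrite KE; apply: X_P => n; exact: open_interior.
exists (\bigcap_n V n); last by move=> y /KV0/V0O[].
split; [exact: lindelof_closed_subset lV0 cK KV0|by []|split].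
  by apply: open_nbhs_nbhs; split=> // n _; exact: nbhs_singleton.
move=> y /KV0/V0O[_ Wy] xy; suff : [set x] y by [].
by rewrite -WE; split=> //; rewrite cb_derivative_level.
Qed.

Variable th : ord.

Definition space_system : system := @System X [set x | level_of x < th]
  (@lindelof_clopen_cone X) (@level_of X).

Lemma space_system_LLSP : LLSP_system space_system.
Proof.
split=> /=.
- by move=> x A _ [_ _ [/nbhs_singleton]].
- move=> x A xth [_ _ [_ cA]] y Ay /=.
  case: (ltP (level_of y) (level_of x)) => [yx|/(cA _ Ay) ->//].
  exact: lt_trans xth.
- move=> x A y _ [_ [oA _] _] Ay; apply: cone_basis.
  by apply: open_nbhs_nbhs.
- move=> x F _ cF Fx.
  have [|A xA AF] := @cone_basis x (\bigcap_(A in F) A).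
    apply: open_nbhs_nbhs; split; last by move=> A /Fx[_ _ [/nbhs_singleton]].
    by apply: P_space_bigcap => // A /Fx[_ []].
  by exists A => // B FB y /AF; exact.
- move=> x y _ _ xy.
  have := X_haus; rewrite open_hausdorff => /(_ x y)[]; first exact/eqP.
  move=> [A B] /= [/set_mem Ax /set_mem By] [oA oB /eqP AB].
  have [A' xA' A'A] := cone_basis (open_nbhs_nbhs (conj oA Ax)).
  have [B' yB' B'B] := cone_basis (open_nbhs_nbhs (conj oB By)).
  exists A', B'; split=> //; apply/seteqP; split=> // z [/A'A Az /B'B Bz].
  exact: disjoint_elim AB Az Bz.
- move=> x A V _ [lA _ _] AV; pose V' := [set interior W | W in V].
  have [|y Ay|F [FV' cF AF]] := lA V'.
  - by move=> _ [W _ <-]; exact: open_interior.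
  - have [W [A' [VW [_ _ [yA' _]] A'W]]] := AV y Ay.
    by exists (interior W); [exists W|exact: filterS A'W yA'].
  apply: (ccov_trans (V' := V')); first by exists F.
  by move=> _ [W VW <-]; apply: ccov1 VW _; exact: interior_subset.
- move=> x A y _ [_ _ [_ cA]] Ay yx; rewrite ltNge; apply/negP => /(cA _ Ay).
  exact: yx.
- move=> x A c _ [_ _ [xA _]] cx.
  have := (level_ofP x).1; rewrite cb_derivativeE => /(_ c cx)[xc nx].
  apply: contrapT => nex; apply: nx; split; first exact: mem_set.
  exists A => //; apply/seteqP; split=> [y [Ay yc]|_ ->]; last first.
    by split=> //; exact: nbhs_singleton.
  apply: contrapT => yx; apply: nex; exists y; split=> //.
  by move: yc; rewrite cb_derivative_level.
Qed.

(** * Goodness of the truncated space *)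

Hypotheses (X_good : good X) (X_width : width X = omega1).
Hypotheses (X_adm : admissible X) (X_height : osucc ord_zero < height X).
Hypotheses (th_gt0 : ord_zero < th) (th_le : th <= height X).

Lemma level_width a : cb_level X a #<= below omega1.
Proof.
have [a_lt|a_ge] := ltP a (height X); last first.
  rewrite (_ : cb_level X a = set0) ?card_ge0 //; apply/seteqP; split=> // x [xa _].
  have := cb_derivative_le a_ge xa.
  by have [//|-> _] := @leastP [set a | cb_derivative X a = set0].
(* The default value [ord_zero] of [least] differs from [omega1], so the width really bounds the
   levels. *)
have := X_width; rewrite /width /least; case: xgetP => [k _ [[_ kP] _] <-|_ om0].
  exact: kP.
by have := ord_zero_lt_omega1; rewrite om0 ltxx.
Qed.

Lemma admissible_family (x : X) b : cb_level X (osucc b) x -> osucc b < height X ->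
  exists (W : ord -> set X) (w : ord -> X),
  [/\ forall nu, nu < omega1 ->
        level_of (w nu) = b /\ lindelof_clopen_cone (w nu) (W nu),
      forall nu mu, nu < omega1 -> mu < omega1 -> nu <> mu ->
        W nu `&` W mu = set0,
      forall A, nbhs x A -> countable [set nu | nu < omega1 /\ ~ W nu `<=` A] &
      forall xi, xi < omega1 -> exists2 A, lindelof_clopen_cone x A &
        A `<=` [set x] `|` \bigcup_(nu in [set nu | xi <= nu < omega1]) W nu].
Proof.
move=> xb b_lt; have [B [Bbasis /(_ b b_lt)[/(_ x xb)[W [Wtriv Wcone BE]] _]]] := X_adm.
have [|w wP] := @choice_on _ _ x (below omega1) (fun nu y =>
    cb_level X b y /\ lindelof_clopen_cone y (W nu)).
  by move=> nu /Wcone[y]; exists y.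
exists W, w; split.
- by move=> nu /wP[]; rewrite cb_level_level.
- move=> nu mu nu_lt mu_lt nm; apply: contrapT => /eqP/set0P W0.
  by apply: nm; exact: Wtriv W0.
- move=> A /(Bbasis x).2[V]; rewrite BE => -[xi /= xi_lt <-] VA.
  apply: sub_countable (iffRL (countable_below xi) xi_lt).
  apply: subset_card_le => nu [nu_lt nWA]; rewrite /below /= ltNge.
  apply/negP => xi_le; apply: nWA => y Wy; apply: VA; right.
  by exists nu => //=; rewrite xi_le.
- move=> xi xi_lt; apply: cone_basis; apply: (Bbasis x).1; rewrite BE.
  by exists xi.
Qed.

Lemma space_system_good : good_system th space_system.
Proof.
have lev_ne a : a < height X -> exists x, cb_level X a x.
  move=> a_lt; apply: contrapT => nx.
  have [x] : exists x : X, True.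
    apply: contrapT => X0; have : height X <= ord_zero.
      apply: least_le; rewrite /= cb_derivative0; apply/seteqP.
      by split=> // y _; apply: X0; exists y.
    by rewrite leNgt (lt_le_trans th_gt0).
  move=> _; have [K xK _] := cone_basis (@filterT _ (nbhs x) _).
  apply: (X_good a_lt (U := fun=> K)); first by move=> _; exists x.
  rewrite (_ : _ `\` _ = set0) //; apply/seteqP; split=> // y [ya _].
  by apply: nx; exists y.
split.
- exact: space_system_LLSP.
- by [].
- move=> e F e_th cF FS.
  have e_lt := lt_le_trans e_th th_le.
  have [x xe] := lev_ne e e_lt; have [K xK _] := cone_basis (@filterT _ (nbhs x) _).
  (* [good] speaks of sequences and [F] may be empty, so an arbitrary cone [K] is added before
     enumerating. *)
  have [g gE] : exists g : nat -> set X, F `|` [set K] = range g.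
    have : countable (F `|` [set K]).
      by rewrite -bigcup2E; apply: bigcup_countable => // -[|[|i]] _ //=.
    move=> /pfcard_geP[F0|[g]]; last by exists g; apply/esym; exact: image_eq.
    suff : (F `|` [set K]) K by rewrite F0.
    by right.
  move=> ce; apply: (X_good e_lt (U := g)) => [n|].
    have [/FS[y _ yg]|->] : (F `|` [set K]) (g n) by rewrite gE; exists n.
      by exists y.
    by exists x.
  apply: sub_countable ce; apply: subset_card_le => y [].
  rewrite cb_level_level => /= ye ny; split; first by split=> //=; rewrite ye.
  move=> [A FA Ay]; apply: ny; have [n _ gn] : range g A by rewrite -gE; left.
  by exists n => //; rewrite gn.
- move=> e; apply: card_le_trans (level_width e); apply: subset_card_le => x.
  by rewrite cb_level_level => -[].
(* The cones below a point of level one are disjoint, so their apexes are [omega1] many isolated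
   points. *)
- have [x x1] := lev_ne _ X_height.
  have [W [w [wP Wdisj _ _]]] := admissible_family x1 X_height.
  apply: (@card_le_inj _ _ w) => [nu /wP[w0 _]|nu mu nu_lt mu_lt nm].
    by split; rewrite /= w0.
  apply: contrapT => /(Wdisj _ _ nu_lt mu_lt) W0.
  have [_ [_ _ [/nbhs_singleton Wnu _]]] := wP nu nu_lt.
  have [_ [_ _ [/nbhs_singleton Wmu _]]] := wP mu mu_lt.
  by apply: (disjoint_elim W0 Wnu); rewrite nm.
Qed.

End SpaceSystem.

(** * The construction *)

Lemma lt_card_succ (k a : ord) : a < card_succ k -> below a #<= below k.
Proof.
move=> a_lt; have [c [c_card ca eqc]] := cardinal_of a.
have ck : c <= k.
  rewrite leNgt; apply/negP => kc; have : card_succ k <= c by exact: least_le.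
  by rewrite leNgt (le_lt_trans ca).
apply: (@card_le_trans _ _ _ (below c)); first by have /card_eqPle[] := eqc.
by apply: subset_card_le => b; rewrite /below /= => /lt_le_trans; exact.
Qed.

(** With [f] listing [below al] along [k], [sg] is the strictly increasing continuous map with
    [sg (osucc eta)] at least [f eta]. As [k] is a limit, [sg k] reaches [al]; [th] is the first
    stage that does. *)
Lemma cofinal_sequence (k al : ord) : (forall a, a < k -> osucc a < k) ->
  below al #<= below k -> ord_zero < al ->
  exists (th : ord) (sg : ord -> ord),
  [/\ ord_zero < th <= k, sg ord_zero = ord_zero,
      forall a b, a < b -> sg a < sg b,
      forall a c, ~ is_succ a -> c < sg a -> exists2 b, b < a & c <= sg b &
      (forall a, a < th -> sg a < al) /\
      (forall e, e < al -> exists2 a, a < th & e <= sg a)].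
Proof.
move=> k_lim /card_le_injP[g g_k g_inj] al0.
have [f f_al f_surj] : exists2 f : ord -> ord, (forall a, f a < al) &
    forall e, e < al -> exists2 a, a < k & f a = e.
  exists (fun a => xget ord_zero [set e | e < al /\ g e = a]) => [a|e e_al].
    by case: xgetP => [e _ []|_].
  exists (g e); first exact: g_k.
  have := @xgetPex _ ord_zero [set e' | e' < al /\ g e' = g e].
  move=> [|e'_al ge]; first by exists e.
  exact: g_inj.
pose sg := orec ord_zero (fun eta v => Order.max (osucc v) (f eta)).
have sgP xi eta : eta < xi -> osucc (sg eta) <= sg xi /\ f eta <= sg xi.
  move=> /((orecP ord_zero (fun eta v => Order.max (osucc v) (f eta)) xi).2).
  by rewrite ge_max => /andP.
have sg_lt a b : a < b -> sg a < sg b by move=> /sgP[]; rewrite osucc_le.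
have sg_inv xi c : c < sg xi ->
    exists2 eta, eta < xi & c <= sg eta \/ c < f eta.
  move=> /lt_orec[|[eta eta_xi]]; first by rewrite ord_wlt0.
  rewrite lt_max lt_osuccE => /orP cs; by exists eta.
have sg_le xi b : (forall eta, eta < xi -> osucc (sg eta) <= b /\ f eta <= b) ->
    sg xi <= b.
  move=> hb; apply: orec_le => [|eta /hb[? ?]]; first exact: ord_zero_le.
  by rewrite ge_max; apply/andP.
have al_k : al <= sg k.
  rewrite leNgt; apply/negP => /f_surj[eta eta_k fE].
  have := sg_lt _ _ (k_lim _ eta_k); rewrite ltNge -fE.
  by rewrite (sgP _ _ (lt_osucc eta)).2.
have [|/= al_th thmin] := @leastP [set xi | al <= sg xi]; first by exists k.
set th := least _ in al_th thmin.
have sg0 : sg ord_zero = ord_zero.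
  by apply/le_anti; rewrite ord_zero_le andbT; apply: sg_le => eta; rewrite ord_wlt0.
have lt_th a : a < th -> sg a < al.
  by move=> a_th; rewrite ltNge; apply/negP => /thmin; rewrite leNgt a_th.
exists th, sg; split=> //.
- rewrite (thmin k) // andbT ord_zero_lt; apply/eqP => th0.
  by move: al_th; rewrite th0 sg0 leNgt al0.
- move=> a c nsa /sg_inv[eta eta_a cs]; exists (osucc eta).
    rewrite lt_neqAle osucc_le eta_a andbT; apply/eqP => aE.
    by apply: nsa; exists eta.
  have [eta_lt f_le] := sgP _ _ (lt_osucc eta).
  case: cs => [cs|/ltW/le_trans]; last exact.
  by apply: le_trans cs _; apply: ltW; exact: sg_lt _ _ (lt_osucc eta).
split=> // e e_al; have [eta eta_th] := sg_inv _ _ (lt_le_trans e_al al_th).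
case=> [e_le|e_lt]; first by exists eta.
have [S_th|th_S] := ltP (osucc eta) th.
  by exists (osucc eta) => //; apply: le_trans (ltW e_lt) (sgP _ _ (lt_osucc eta)).2.
(* When [th = osucc eta], [f eta < al] forces [al <= osucc (sg eta)], so [sg eta] already dominates
   [e]. *)
exists eta => //; rewrite -lt_osuccE; apply: lt_le_trans e_al _.
have {}th_S : th = osucc eta by apply/le_anti; rewrite th_S osucc_le eta_th.
have : al <= Order.max (osucc (sg eta)) (f eta).
  apply: le_trans al_th _; rewrite th_S; apply: sg_le => xi.
  rewrite lt_osuccE le_eqVlt => /predU1P[->|xi_eta].
    by rewrite !le_max !lexx orbT.
  have [s_le f_le] := sgP _ _ xi_eta.
  by split; rewrite le_max (le_trans _ (ltW (lt_osucc (sg eta)))).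
by rewrite le_max => /orP[//|]; rewrite leNgt f_al.
Qed.

(* What is inserted below a point [x] of successor level: a system [ins_sys] *)
(* with greatest point [ins_top] replacing [x], whose points [z] of rank [0] *)
(* are identified with the points [ins_pt z] below [x].                      *)
Record insertion (X : Type) := Insertion {
  ins_sys : system;
  ins_top : point_of ins_sys;
  ins_set : point_of ins_sys -> set X;
  ins_pt : point_of ins_sys -> X }.
Arguments ins_top {X}.

Record insertion_at (X : system) (x : point_of X) (g : ord)
    (P : insertion (point_of X)) : Prop := InsertionAt {
  ia_sys : LLSP_system (ins_sys P);
  ia_top : domain (ins_sys P) (ins_top P);
  ia_bas : bas (ins_top P) (domain (ins_sys P));
  ia_rank : rank (ins_top P) = g;
  ia_pt : forall z, level (ins_sys P) ord_zero z -> domain X (ins_pt z);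
  ia_pt_rank : forall z, level (ins_sys P) ord_zero z ->
    osucc (rank (ins_pt z)) = rank x;
  ia_set : forall z, level (ins_sys P) ord_zero z -> bas (ins_pt z) (ins_set z);
  ia_disj : forall z z', level (ins_sys P) ord_zero z ->
    level (ins_sys P) ord_zero z' -> z <> z' -> ins_set z `&` ins_set z' = set0;
  ia_inside : forall A, bas x A ->
    countable [set z | level (ins_sys P) ord_zero z /\ ~ ins_set z `<=` A];
  ia_tail : forall C, countable C -> exists2 A, bas x A &
    A `<=` [set x] `|` \bigcup_(z in level (ins_sys P) ord_zero `\` C) ins_set z;
  ia_uncountable : forall d, d < g -> ~ countable (level (ins_sys P) d);
  ia_width : forall d, level (ins_sys P) d #<= below omega1 }.

Lemma level0_enum (g : ord) (S : system) : good_system g S ->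
  exists j : point_of S -> ord,
  [/\ forall z, level S ord_zero z -> j z < omega1,
      forall z z', level S ord_zero z -> level S ord_zero z' -> j z = j z' -> z = z' &
      forall nu, nu < omega1 -> exists2 z, level S ord_zero z & j z = nu].
Proof.
move=> SG; have : level S ord_zero #= below omega1.
  by apply/card_eqPle; split; [exact: gs_width SG _|exact: gs_level0 SG].
move=> /card_set_bijP[j [j_fun j_inj j_surj]]; exists j; split.
- by move=> z /j_fun.
- by move=> z z' Lz Lz'; apply: j_inj; exact: mem_set.
- by move=> nu /j_surj[z Lz jz]; exists z.
Qed.

Lemma insertion_exists (X : topologicalType) (XL : LLSP X) (th g b : ord)
  (S : system) (x : X) : admissible X -> osucc b < height X -> osucc b < th ->
  level_of x = osucc b -> ord_zero < g -> good_system g S ->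
  exists P, insertion_at (X := space_system X th) x g P.
Proof.
move=> Xadm b_ht b_th xb g0 SG; have SS := gs_sys SG.
have [|W [w [wP Wdisj Win Wtail]]] := admissible_family XL Xadm _ b_ht (x := x).
  by rewrite cb_level_level.
have [j [j_lt j_inj j_surj]] := level0_enum SG.
pose T := one_point g S.
pose U (o : point_of T) := if o is Some z then W (j z) else set0.
pose u (o : point_of T) := if o is Some z then w (j z) else x.
(* As [g] is positive, infinity is not matched with a cone. *)
have lev0 o : level T ord_zero o -> exists2 z, o = Some z & level S ord_zero z.
  case: o => [z|] [/= Dz z0]; first by exists z.
  by rewrite z0 ltxx in g0.
exists (@Insertion X T None U u); split => /=.
- exact: one_point_system.
- by [].
- exact: one_point_domain.
- by [].
- move=> _ /lev0[z -> /j_lt/wP[wb _]]; rewrite /= wb.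
  by apply: lt_trans b_th; exact: lt_osucc.
- by move=> _ /lev0[z -> /j_lt/wP[wb _]]; rewrite /= wb.
- by move=> _ /lev0[z -> /j_lt/wP[]].
- move=> _ _ /lev0[z -> Lz] /lev0[z' -> Lz'] zz'; apply: Wdisj; try exact: j_lt.
  by move=> /(j_inj _ _ Lz Lz') zE; apply: zz'; rewrite zE.
- move=> A [_ _ [xA _]]; apply: sub_countable (Win A xA).
  apply: (@card_le_inj _ _ (fun o => if o is Some z then j z else ord_zero)).
    by move=> _ [/lev0[z -> Lz] nUA]; split=> //; exact: j_lt.
  move=> _ _ [/lev0[z -> Lz] _] [/lev0[z' -> Lz'] _] /j_inj -> //.
- move=> C cC.
  (* Regularity of [omega1]: the countably many indices matched with [C] lie below some [xi], and
     the tail from [xi] avoids them. *)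
  have [||xi xi_lt Cxi] :=
    @countable_bound_omega1 (j @` [set z | level S ord_zero z /\ C (Some z)]).
  - apply: sub_countable (card_image_le _ _) _; apply: sub_countable cC.
    by apply: (@card_le_inj _ _ Some) => [z []//|z z' _ _ []].
  - by move=> _ [z [Lz _] <-]; exact: j_lt.
  have [A xA AU] := Wtail xi xi_lt; exists A => // y /AU[->|]; first by left.
  move=> [nu /andP[xi_nu /j_surj[z Lz jz]] Wy]; right; exists (Some z).
    split=> // Cz; have : j z < xi by apply: Cxi; exists z.
    by rewrite jz ltNge xi_nu.
  by rewrite /= jz.
- move=> d dg cT; apply: (gs_good SG dg (countable0 _) (@sub0set _ _)).
  apply: sub_countable cT; apply: (@card_le_inj _ _ Some) => [z [[Dz zd] _]|z z' _ _ []//].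
  by [].
- move=> d; have [dg|dg] := eqVneq d g.
    apply: (@card_le_inj _ _ (fun=> ord_zero)) => [_ _|].
      exact: ord_zero_lt_omega1.
    have aux o : level T d o -> o = None.
      case: o => // z [/= Dz zd]; have := gs_lt SG Dz.
      by rewrite zd dg ltxx.
    by move=> o o' /aux -> /aux ->.
  apply: card_le_trans (gs_width SG d).
  apply: (@card_le_trans _ _ _ (Some @` level S d)); last exact: card_image_le.
  apply: subset_card_le => -[z|] [/= Dz zd]; first by exists z.
  by rewrite zd eqxx in dg.
Qed.

Lemma good_system_step (X : topologicalType) (k al : ord) :
  LLSP_of omega1 k X -> good X -> admissible X ->
  (forall a, a < k -> osucc a < k) -> ord_zero < k ->
  below al #<= below k -> ord_zero < al ->
  (forall g, ord_zero < g -> g < al -> exists S, good_system g S) ->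
  exists S, good_system al S.
Proof.
move=> [XL Xh Xw] Xg Xadm k_lim k0 al_k al0 IH.
have [th [sg [/andP[th0 th_k] sg0 sg_lt sg_lim [sg_al al_sg]]]] :=
  cofinal_sequence k_lim al_k al0.
have XG : good_system th (space_system X th).
  by apply: space_system_good => //; rewrite Xh //; exact: k_lim.
have [|gam gamP] := @choice_on _ _ ord_zero setT
    (fun b c => sg (osucc b) = oadd (sg b) c).
  by move=> b _; apply: oadd_sub; apply: ltW; apply: sg_lt; exact: lt_osucc.
have gam0 b : ord_zero < gam b.
  rewrite ord_zero_lt; apply/eqP => g0; have := sg_lt _ _ (lt_osucc b).
  by rewrite gamP // g0 oadd0 ltxx.
have [x0 _] : exists x0 : X, True.
  have [L0|/set0P[x _]] := eqVneq (level (space_system X th) ord_zero) set0.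
    case: (gs_good XG th0 (countable0 _) (@sub0set _ _)).
    by rewrite L0 set0D.
  by exists x.
pose D := [set x : X | level_of x < th /\ is_succ (level_of x)].
have [x [xth sx]|P PP] := @choice_on _ _
    (@Insertion X (@System unit set0 (fun=> set0) (fun=> ord_zero)) tt
       (fun=> set0) (fun=> x0)) D
    (fun x P => insertion_at (X := space_system X th) x (gam (opred (level_of x))) P).
  have xE := osucc_opred sx; set b := opred (level_of x) in xE *.
  have b_th : osucc b < th by rewrite xE.
  have [S SG] : exists S, good_system (gam b) S.
    (* The induction applies since [gam b] is at most [oadd (sg b) (gam b)], that is [sg (osucc b)],
       which is below [al]. *)
    apply: IH => //; apply: le_lt_trans (sg_al _ b_th); rewrite gamP //.
    exact: oadd_ge.
  apply: (insertion_exists XL Xadm _ b_th _ (gam0 b) SG); last by rewrite xE.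
  by rewrite Xh; exact: lt_le_trans b_th th_k.
have {}PP x : domain (space_system X th) x -> is_succ (level_of x) ->
    insertion_at (X := space_system X th) x (gam (opred (level_of x))) (P x).
  by move=> Dx sx; apply: PP.
exists (@substitution (space_system X th) (fun x => ins_sys (P x))
  (fun x => ins_top (P x)) (fun x z => ins_set z) sg).
apply: (@substitution_good _ (gs_sys XG) _ _ _ (fun x z => ins_pt z)
  _ _ _ _ _ _ _ _ _ _ _ sg_lt _ sg_lim th al XG sg0 sg_al al_sg _ _).
- by move=> x Dx sx; exact: ia_sys (PP x Dx sx).
- by move=> x Dx sx; exact: ia_top (PP x Dx sx).
- by move=> x Dx sx; exact: ia_bas (PP x Dx sx).
- by move=> x Dx sx; rewrite (ia_rank (PP x Dx sx)).
- by move=> x z Dx sx Lz; exact: (ia_pt (PP x Dx sx) Lz).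
- by move=> x z Dx sx Lz; exact: (ia_pt_rank (PP x Dx sx) Lz).
- by move=> x z Dx sx Lz; exact: (ia_set (PP x Dx sx) Lz).
- by move=> x z z' Dx sx Lz Lz'; exact: (ia_disj (PP x Dx sx) Lz Lz').
- by move=> x A Dx sx xA; exact: (ia_inside (PP x Dx sx) xA).
- by move=> x C Dx sx cC; exact: (ia_tail (PP x Dx sx) cC).
- by move=> x Dx sx; rewrite (ia_rank (PP x Dx sx)) -gamP // osucc_opred.
- by move=> x d Dx sx; rewrite (ia_rank (PP x Dx sx)); exact: ia_uncountable (PP x Dx sx) _.
- by move=> x d Dx sx; exact: ia_width (PP x Dx sx) _.
Qed.

Theorem theorem3p3 (lambda : ord)
    (lambda_card : is_cardinal lambda) (lambda_ge : omega2 <= lambda)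
    (hX : exists X : topologicalType,
      [/\ LLSP_of omega1 lambda X, good X & admissible X])
    (alpha : ord) (alpha_gt0 : ord_zero < alpha)
    (alpha_lt : alpha < card_succ lambda) :
  exists Y : topologicalType, LLSP_of omega1 alpha Y /\ good Y.
Proof.
have [X [XL Xg Xa]] := hX.
have om1_lt := lt_le_trans omega1_lt_omega2 lambda_ge.
have lim := cardinal_limit lambda_card om1_lt.
suff [S SG] : exists S, good_system alpha S.
  by exists (system_space (gs_sys SG)); exact: system_space_LLSP.
elim/(well_founded_ind ord_lt_wf): alpha alpha_gt0 alpha_lt => alpha IH alpha0 alpha_lt.
apply: good_system_step XL Xg Xa lim _ (lt_card_succ alpha_lt) alpha0 _.
  exact: le_lt_trans (ord_zero_le _) om1_lt.
by move=> g g0 g_lt; apply: IH => //; exact: lt_trans alpha_lt.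
Qed.
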